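(* The Hopf algebras $(H,\sqcup\!\sqcup,\Delta)$ and $(H,\sqcup\!\sqcup^{\mathsf{qs}},\Delta)$ on matrix compositions, with $\sqcup\!\sqcup$ the two-parameter shuffle product, $\sqcup\!\sqcup^{\mathsf{qs}}$ the two-parameter quasi-shuffle product and $\Delta$ the coproduct of deconcatenation along the diagonal, are isomorphic (as Hopf algebras).
   Context: $\mathbb{K}$ is a commutative $\mathbb{Q}$-algebra, $d\ge 1$, and $(\mathfrak{M}_d,\star,\varepsilon)$ is the free commutative monoid generated by $d$ letters, with neutral element $\varepsilon$. A matrix composition is either the empty composition $\mathsf{e}$ (with $0$ rows and $0$ columns) or a matrix of size $m\times n$, $m,n\ge 1$, with entries in $\mathfrak{M}_d$ having no row and no column consisting only of $\varepsilon$. $\mathrm{Comp}$ is the set of matrix compositions and $H=\bigoplus_{\mathbf{a}\in\mathrm{Comp}}\mathbb{K}\mathbf{a}$. For $\mathbf{a},\mathbf{b}\in\mathrm{Comp}$, $\mathrm{diag}(\mathbf{a},\mathbf{b})$ is the block diagonal matrix with blocks $\mathbf{a},\mathbf{b}$ and all off-diagonal-block entries equal to $\varepsilon$; $\mathsf{e}$ is neutral for $\mathrm{diag}$. A nonempty $\mathbf{c}\in\mathrm{Comp}$ is connected if $\mathbf{c}=\mathrm{diag}(\mathbf{a},\mathbf{b})$ implies $\mathbf{a}=\mathsf{e}$ or $\mathbf{b}=\mathsf{e}$. Every nonempty composition is uniquely $\mathrm{diag}(\mathbf{u}_1,\dots,\mathbf{u}_\ell)$ with all $\mathbf{u}_i$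 connected. The coproduct $\Delta:H\to H\otimes H$ is linear with $\Delta(\mathsf{e})=\mathsf{e}\otimes\mathsf{e}$ and $\Delta(\mathrm{diag}(\mathbf{u}_1,\dots,\mathbf{u}_\ell))=\sum_{\alpha=0}^{\ell}\mathrm{diag}(\mathbf{u}_1,\dots,\mathbf{u}_\alpha)\otimes\mathrm{diag}(\mathbf{u}_{\alpha+1},\dots,\mathbf{u}_\ell)$ for connected $\mathbf{u}_i$ (an empty $\mathrm{diag}$ is $\mathsf{e}$). The unit is $\mathsf{e}$; the counit sends $\mathsf{e}\mapsto 1$ and every nonempty composition to $0$. Products on $H$ (bilinear with neutral element $\mathsf{e}$), for nonempty $\mathbf{a}$ (size $m\times n$) and $\mathbf{b}$ (size $s\times t$): Two-parameter shuffle: $\mathbf{a}\sqcup\!\sqcup\mathbf{b}=\sum_{p\in\mathrm{sh}(m,s)}\sum_{q\in\mathrm{sh}(n,t)}(\mathrm{diag}(\mathbf{a},\mathbf{b})_{p^{-1}(u),q^{-1}(v)})_{u,v}$, where $\mathrm{sh}(m,s)$ is the set of permutations $q$ of $\{1,\dots,m+s\}$ with $q(1)<\dots<q(m)$ and $q(m+1)<\dots<q(m+s)$. Two-parameter quasi-shuffle: $\mathbf{a}\sqcup\!\sqcup^{\mathsf{qs}}\mathbf{b}=\sum_{j,k\ge1}\sum_{p\in\mathrm{qsh}(m,s;j)}\sum_{q\in\mathrm{qsh}(n,t;k)}\mathbf{c}^{p,q}$, where $\mathbf{c}^{p,q}$ is the $j\times k$ matrix with entries $\mathbf{c}^{p,q}_{x,y}=\bigstar_{u\in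 p^{-1}(x),\,v\in q^{-1}(y)}\mathrm{diag}(\mathbf{a},\mathbf{b})_{u,v}$, and $\mathrm{qsh}(m,s;j)$ is the set of surjections $q:\{1,\dots,m+s\}\to\{1,\dots,j\}$ with $q(1)<\dots<q(m)$ and $q(m+1)<\dots<q(m+s)$. Both $(H,\sqcup\!\sqcup,\Delta)$ and $(H,\sqcup\!\sqcup^{\mathsf{qs}},\Delta)$ are graded connected commutative Hopf algebras (graded by the total number of letters in the entries). *)

(* Defs.v *)
From HB Require Import structures.
From mathcomp Require Import all_boot all_order all_algebra all_fingroup.
From mathcomp Require Import finmap.
From mathcomp Require Import monalg.
From Stdlib Require Import Classical IndefiniteDescription.

Set Implicit Arguments.
Unset Strict Implicit.
Unset Printing Implicit Defensive.

Import GRing.Theory.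

Local Open Scope ring_scope.

(* The free K-module on a basis I is {malg K[I]}, with basis vectors << a >>.
   The tensor product of the free modules on I and on J is taken to be the free
   module on I * J, with << (a, b) >> standing for << a >> (x) << b >>.
   ({malg K[I]} only carries a ring structure when I is a monomType, and none
   is declared on the bases used here.) *)
Section FreeModules.
Variable K : comNzRingType.

Definition lin_ext (I : choiceType) (V : lmodType K) (f : I -> V)
    (x : {malg K[I]}) : V :=
  \sum_(a <- msupp x) x@_a *: f a.

Definition bilin_ext (I J : choiceType) (V : lmodType K) (f : I -> J -> V)
    (x : {malg K[I]}) (y : {malg K[J]}) : V :=
  lin_ext (fun a => lin_ext (f a) y) x.

Definition tensor (I J : choiceType) :
    {malg K[I]} -> {malg K[J]} -> {malg K[(I * J)%type]} :=
  bilin_ext (fun a b => << (a, b) >>).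

Definition tensor_map (I J I' J' : choiceType)
    (f : {malg K[I]} -> {malg K[I']}) (g : {malg K[J]} -> {malg K[J']}) :
    {malg K[(I * J)%type]} -> {malg K[(I' * J')%type]} :=
  lin_ext (fun ab => tensor (f << ab.1 >>) (g << ab.2 >>)).

(* Only the operations are recorded. The antipode, which is determined by
   them, is characterised by [is_antipode]. *)
Record hopf_ops (I : choiceType) := HopfOps {
  hmul : {malg K[I]} -> {malg K[I]} -> {malg K[I]};
  hone : {malg K[I]};
  hcomul : {malg K[I]} -> {malg K[(I * I)%type]};
  hcounit : {malg K[I]} -> K
}.

Definition convolution (I : choiceType) (A : hopf_ops I)
    (f g : {malg K[I]} -> {malg K[I]}) (x : {malg K[I]}) : {malg K[I]} :=
  lin_ext (fun ab => hmul A (f << ab.1 >>) (g << ab.2 >>)) (hcomul A x).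

Definition is_antipode (I : choiceType) (A : hopf_ops I)
    (S : {linear {malg K[I]} -> {malg K[I]}}) : Prop :=
  forall x, convolution A S id x = hcounit A x *: hone A
         /\ convolution A id S x = hcounit A x *: hone A.

Record is_hopf_iso (I J : choiceType) (A : hopf_ops I) (B : hopf_ops J)
    (f : {linear {malg K[I]} -> {malg K[J]}}) : Prop := IsHopfIso {
  hopf_iso_bij : bijective f;
  hopf_iso_one : f (hone A) = hone B;
  hopf_iso_mul : forall x y, f (hmul A x y) = hmul B (f x) (f y);
  hopf_iso_counit : forall x, hcounit B (f x) = hcounit A x;
  hopf_iso_comul : forall x, hcomul B (f x) = tensor_map f f (hcomul A x);
  hopf_iso_antipode : forall SA SB, is_antipode A SA -> is_antipode B SB ->
    forall x, f (SA x) = SB (f x)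
}.

Definition hopf_isomorphic (I J : choiceType)
    (A : hopf_ops I) (B : hopf_ops J) : Prop :=
  exists f : {linear {malg K[I]} -> {malg K[J]}}, is_hopf_iso A B f.

End FreeModules.

Section MatrixCompositions.
Variable d : nat.

Local Notation M := {cmonom 'I_d}.
Local Notation eps := (@mone M).

(* For m = 0 < n (or n = 0 < m) every column (row) is vacuously trivial, so the
   condition below leaves the 0 x 0 matrix as the only degenerate case. *)
Definition no_trivial_line (m n : nat) (A : 'M[M]_(m, n)) : bool :=
  [forall i, exists j, A i j != eps] && [forall j, exists i, A i j != eps].

Record comp := Comp {
  cval : {mn : nat * nat & 'M[M]_(mn.1, mn.2)};
  cvalP : no_trivial_line (tagged cval)
}.

HB.instance Definition _ := [isSub for cval].
HB.instance Definition _ := [Choice of comp by <:].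

Definition nrows (a : comp) : nat := (tag (cval a)).1.
Definition ncols (a : comp) : nat := (tag (cval a)).2.
Definition cmat (a : comp) : 'M[M]_(nrows a, ncols a) := tagged (cval a).

Definition mkcomp (m n : nat) (A : 'M[M]_(m, n)) (AP : no_trivial_line A) :
    comp :=
  @Comp (existT (fun mn : nat * nat => 'M[M]_(mn.1, mn.2)) (m, n) A) AP.

Lemma no_trivial_lineP (m n : nat) (A : 'M[M]_(m, n)) :
  reflect ((forall i, exists j, A i j != eps) /\
           (forall j, exists i, A i j != eps)) (no_trivial_line A).
Proof.
apply: (iffP andP) => -[hr hc]; split.
- by move=> i; apply/existsP; move/forallP: hr.
- by move=> j; apply/existsP; move/forallP: hc.
- by apply/forallP => i; apply/existsP.
- by apply/forallP => j; apply/existsP.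
Qed.

Lemma cmatP (a : comp) : no_trivial_line (cmat a).
Proof. exact: cvalP. Qed.

Definition emptyM : 'M[M]_(0, 0) := const_mx eps.

Fact emptyM_subproof : no_trivial_line emptyM.
Proof. by apply/no_trivial_lineP; split => -[]. Qed.

Definition cempty : comp := mkcomp emptyM_subproof.

Definition diagM (m n s t : nat) (A : 'M[M]_(m, n)) (B : 'M[M]_(s, t)) :
    'M[M]_(m + s, n + t) :=
  block_mx A (const_mx eps) (const_mx eps) B.

Fact cdiag_subproof (a b : comp) : no_trivial_line (diagM (cmat a) (cmat b)).
Proof.
have /no_trivial_lineP [ra ca] := cmatP a.
have /no_trivial_lineP [rb cb] := cmatP b.
apply/no_trivial_lineP; split=> i; case: (split_ordP i) => k ->.
- by have [j hj] := ra k; exists (lshift _ j); rewrite block_mxEul.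
- by have [j hj] := rb k; exists (rshift _ j); rewrite block_mxEdr.
- by have [j hj] := ca k; exists (lshift _ j); rewrite block_mxEul.
- by have [j hj] := cb k; exists (rshift _ j); rewrite block_mxEdr.
Qed.

Definition cdiag (a b : comp) : comp := mkcomp (cdiag_subproof a b).

Definition cdiags (us : seq comp) : comp := \big[cdiag/cempty]_(u <- us) u.

Definition connected (c : comp) : Prop :=
  c <> cempty /\ forall a b, c = cdiag a b -> a = cempty \/ b = cempty.

(* Entries indexed by plain natural numbers, [eps] out of range. *)
Definition centry (a : comp) (i j : nat) : M :=
  if insub i is Some i' then
    if insub j is Some j' then cmat a i' j' else eps
  else eps.

Lemma centryE (a : comp) (i : 'I_(nrows a)) (j : 'I_(ncols a)) :
  centry a i j = cmat a i j.
Proof. by rewrite /centry !valK. Qed.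

Lemma centry_out (a : comp) (i j : nat) :
  ~~ ((i < nrows a) && (j < ncols a))%N -> centry a i j = eps.
Proof.
rewrite /centry; case: insubP => [i' -> _|//] /=.
by case: insubP => [j' ->|].
Qed.

Lemma comp_eqP (a b : comp) :
  nrows a = nrows b -> ncols a = ncols b ->
  (forall i j, (i < nrows a)%N -> (j < ncols a)%N -> centry a i j = centry b i j) ->
  a = b.
Proof.
case: a => -[[m n] A] hA; case: b => -[[m' n'] B] hB.
rewrite /nrows /ncols /= => em en.
case: _ / em in B hB *; case: _ / en in B hB * => h.
apply: val_inj => /=; congr existT; apply/matrixP => i j.
have := h i j (ltn_ord i) (ltn_ord j).
by rewrite (centryE (a := mkcomp hA)) (centryE (a := mkcomp hB)).
Qed.

Lemma nrows_cdiag (a b : comp) : nrows (cdiag a b) = (nrows a + nrows b)%N.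
Proof. by []. Qed.

Lemma ncols_cdiag (a b : comp) : ncols (cdiag a b) = (ncols a + ncols b)%N.
Proof. by []. Qed.

Lemma centry_cdiag (a b : comp) (i j : nat) :
  centry (cdiag a b) i j =
    if (i < nrows a)%N then centry a i j
    else if (j < ncols a)%N then eps
    else centry b (i - nrows a) (j - ncols a).
Proof.
have [hi|hi] := ltnP i (nrows a + nrows b)%N; last first.
  have ha : (nrows a <= i)%N := leq_trans (leq_addr _ _) hi.
  rewrite centry_out ?nrows_cdiag ?ltnNge ?hi // ha /=.
  by rewrite centry_out ?if_same // !ltnNge leq_subRL // hi.
have [hj|hj] := ltnP j (ncols a + ncols b)%N; last first.
  have ha : (ncols a <= j)%N := leq_trans (leq_addr _ _) hj.
  rewrite centry_out ?ncols_cdiag ?(ltnNge j) ?hj ?andbF // ha /=.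
  rewrite !centry_out ?if_same ?(ltnNge j) ?ha ?andbF //.
  by rewrite [(j - _ < _)%N]ltnNge leq_subRL // hj andbF.
transitivity (diagM (cmat a) (cmat b) (Ordinal hi) (Ordinal hj)).
  exact: (@centryE (cdiag a b) (Ordinal hi) (Ordinal hj)).
rewrite /diagM; set i' := Ordinal hi; set j' := Ordinal hj.
rewrite -[i]/(val i') -[j]/(val j'); move: i' j' => {hi hj} i' j'.
case: (split_ordP i') => k ->; case: (split_ordP j') => l ->.
- by rewrite block_mxEul /= centryE.
- rewrite block_mxEur /= mxE centry_out //.
  by rewrite [(_ + l < _)%N]ltnNge leq_addr andbF.
- by rewrite block_mxEdl mxE.
- by rewrite block_mxEdr /= !addKn centryE.
Qed.

Lemma comp_row (a : comp) (i : nat) :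
  (i < nrows a)%N -> exists2 j, (j < ncols a)%N & centry a i j != eps.
Proof.
move=> hi; have /no_trivial_lineP [+ _] := cmatP a.
by move=> /(_ (Ordinal hi)) [j hj]; exists j; rewrite // -centryE in hj *.
Qed.

Lemma comp_col (a : comp) (j : nat) :
  (j < ncols a)%N -> exists2 i, (i < nrows a)%N & centry a i j != eps.
Proof.
move=> hj; have /no_trivial_lineP [_ +] := cmatP a.
by move=> /(_ (Ordinal hj)) [i hi]; exists i; rewrite // -centryE in hi *.
Qed.

Lemma nrows_eq0 (a : comp) : nrows a = 0%N -> a = cempty.
Proof.
move=> ha; apply: comp_eqP => // [|i j]; last by rewrite ha.
case E: (ncols a) => [//|n].
have [|i] := @comp_col a 0; first by rewrite E.
by rewrite ha.
Qed.

Lemma cdiag0c (a : comp) : cdiag cempty a = a.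
Proof.
by apply: comp_eqP => // i j _ _; rewrite centry_cdiag /= !subn0.
Qed.

Lemma cdiagc0 (a : comp) : cdiag a cempty = a.
Proof.
apply: comp_eqP => [||i j]; rewrite ?nrows_cdiag ?ncols_cdiag ?addn0 //.
by move=> hi hj; rewrite centry_cdiag hi.
Qed.

Lemma cdiagA : associative cdiag.
Proof.
move=> a b c; apply: comp_eqP => [||i j _ _].
- by rewrite !nrows_cdiag addnA.
- by rewrite !ncols_cdiag addnA.
rewrite !centry_cdiag !nrows_cdiag !ncols_cdiag !subnDA.
have [hi|hi] := ltnP i (nrows a); first by rewrite ltn_addr.
rewrite -[(i < _ + _)%N]ltn_subLR // ; have [hj|hj] := ltnP j (ncols a).
  by rewrite (ltn_addr _ hj); case: ifP.
by rewrite -[(j < _ + _)%N]ltn_subLR.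
Qed.

Lemma cdiags_cat (us vs : seq comp) :
  cdiags (us ++ vs) = cdiag (cdiags us) (cdiags vs).
Proof.
rewrite /cdiags; elim: us => [|u us IH]; first by rewrite big_nil cdiag0c.
by rewrite cat_cons !big_cons IH cdiagA.
Qed.

Lemma components_exist (a : comp) :
  exists2 us : seq comp, {in us, forall u, connected u} & cdiags us = a.
Proof.
have [n le_n] := ubnP (nrows a); elim: n => // n IHn in a le_n *.
have [->|a0] := classic (a = cempty).
  by exists [::]; rewrite // /cdiags big_nil.
have [ca|nca] := classic (connected a).
  exists [:: a]; first by move=> u /[!inE] /eqP ->.
  by rewrite /cdiags big_cons big_nil cdiagc0.
have [b [c [ea b0 c0]]] :
    exists b c, [/\ a = cdiag b c, b <> cempty & c <> cempty].
  apply: NNPP => h; apply: nca; split=> // b c ea.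
  have [->|b0] := classic (b = cempty); first by left.
  have [->|c0] := classic (c = cempty); first by right.
  by case: h; exists b, c.
have pos x : x <> cempty -> (0 < nrows x)%N.
  by move=> x0; rewrite lt0n; apply/eqP => /nrows_eq0.
move: le_n; rewrite ea nrows_cdiag ltnS => le_n.
have [|us cus eus] := IHn b.
  by apply: leq_trans le_n; rewrite -{1}[nrows b]addn0 ltn_add2l pos.
have [|vs cvs evs] := IHn c.
  by apply: leq_trans le_n; rewrite -{1}[nrows c]add0n ltn_add2r pos.
exists (us ++ vs); last by rewrite cdiags_cat eus evs.
by move=> u; rewrite mem_cat => /orP[/cus|/cvs].
Qed.

Lemma cdiag_prefix (u a v b : comp) :
  cdiag u a = cdiag v b -> (nrows u <= nrows v)%N ->
  exists w, v = cdiag u w.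
Proof.
move=> e le_r.
have ee i j : centry (cdiag u a) i j = centry (cdiag v b) i j by rewrite e.
have le_c : (ncols u <= ncols v)%N.
  rewrite leqNgt; apply/negP => /comp_col [i hi] /eqP; apply.
  have := ee i (ncols v); rewrite !centry_cdiag hi (leq_trans hi le_r) => ->.
  by rewrite centry_out // ltnn andbF.
pose W : 'M[M]_(nrows v - nrows u, ncols v - ncols u) :=
  \matrix_(i, j) centry v (nrows u + i) (ncols u + j).
have WP : no_trivial_line W.
  apply/no_trivial_lineP; split=> [i|j].
    have hi : (nrows u + i < nrows v)%N by rewrite -ltn_subRL.
    have [j hj ne] := comp_row hi.
    have le_j : (ncols u <= j)%N.
      rewrite leqNgt; apply: contra ne => lt_j.
      have := ee (nrows u + i)%N j; rewrite !centry_cdiag hi => <-.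
      by rewrite ltnNge leq_addr /= lt_j.
    have lt_j : (j - ncols u < ncols v - ncols u)%N by rewrite ltn_sub2rE.
    by exists (Ordinal lt_j); rewrite mxE /= subnKC.
  have hj : (ncols u + j < ncols v)%N by rewrite -ltn_subRL.
  have [i hi ne] := comp_col hj.
  have le_i : (nrows u <= i)%N.
    rewrite leqNgt; apply: contra ne => lt_i.
    have := ee i (ncols u + j)%N; rewrite !centry_cdiag hi lt_i => <-.
    by rewrite centry_out // [(_ + j < _)%N]ltnNge leq_addr andbF.
  have lt_i : (i - nrows u < nrows v - nrows u)%N by rewrite ltn_sub2rE.
  by exists (Ordinal lt_i); rewrite mxE /= subnKC.
exists (mkcomp WP); apply: comp_eqP => [||i j hi hj].
- by rewrite nrows_cdiag [nrows (mkcomp _)]/= subnKC.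
- by rewrite ncols_cdiag [ncols (mkcomp _)]/= subnKC.
have := ee i j; rewrite !centry_cdiag hi.
have [//|le_i] := ltnP i (nrows u); have [//|le_j] := ltnP j (ncols u) => _.
have lt_i : (i - nrows u < nrows v - nrows u)%N by rewrite ltn_sub2rE.
have lt_j : (j - ncols u < ncols v - ncols u)%N by rewrite ltn_sub2rE.
have := @centryE (mkcomp WP) (Ordinal lt_i) (Ordinal lt_j).
by rewrite /= => ->; rewrite [cmat _]/= mxE /= !subnKC.
Qed.

Lemma cdiagI (a : comp) : injective (cdiag a).
Proof.
move=> b c e; have ee i j : centry (cdiag a b) i j = centry (cdiag a c) i j.
  by rewrite e.
have := congr1 nrows e; rewrite !nrows_cdiag => /addnI er.
have := congr1 ncols e; rewrite !ncols_cdiag => /addnI ec.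
apply: comp_eqP => // i j _ _.
have := ee (nrows a + i)%N (ncols a + j)%N.
by rewrite !centry_cdiag !ltnNge !leq_addr /= !addKn.
Qed.

Lemma cdiags_inj (us vs : seq comp) :
  {in us, forall u, connected u} -> {in vs, forall v, connected v} ->
  cdiags us = cdiags vs -> us = vs.
Proof.
have nil_cons u us' : connected u -> cdiags (u :: us') <> cempty.
  case=> u0 _ e; apply: u0; apply: nrows_eq0.
  have := congr1 nrows e; rewrite /cdiags big_cons nrows_cdiag => /eqP.
  by rewrite addn_eq0 => /andP[/eqP].
elim: us vs => [|u us IH] [|v vs] // cu cv.
- move/esym; rewrite {2}/cdiags big_nil => /nil_cons []; apply: cv.
  exact: mem_head.
- rewrite {2}/cdiags big_nil => /nil_cons []; apply: cu; exact: mem_head.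
rewrite /cdiags !big_cons -!/(cdiags _) => e.
have hu := cu u (mem_head _ _); have hv := cv v (mem_head _ _).
have same x y a b : connected x -> connected y -> cdiag x a = cdiag y b ->
    (nrows x <= nrows y)%N -> x = y.
  move=> [x0 _] [_ cy] exy le; have [w ey] := cdiag_prefix exy le.
  by have [//|w0] := cy _ _ ey; rewrite ey w0 cdiagc0.
have euv : u = v.
  by have [/(same _ _ _ _ hu hv e)|/ltnW/(same _ _ _ _ hv hu (esym e))] :=
    leqP (nrows u) (nrows v).
move: e; rewrite euv => /cdiagI /IH -> //.
- by move=> x hx; apply: cu; rewrite inE hx orbT.
- by move=> x hx; apply: cv; rewrite inE hx orbT.
Qed.

Definition components_spec (a : comp) (us : seq comp) : Prop :=
  {in us, forall u, connected u} /\ cdiags us = a.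

Fact components_subproof (a : comp) : exists us, components_spec a us.
Proof. by have [us ? ?] := components_exist a; exists us. Qed.

Definition components (a : comp) : seq comp :=
  proj1_sig (constructive_indefinite_description _ (components_subproof a)).

Lemma components_cdiags (us : seq comp) :
  {in us, forall u, connected u} -> components (cdiags us) = us.
Proof.
move=> cus; rewrite /components.
by case: constructive_indefinite_description => vs /= [cvs /cdiags_inj]; apply.
Qed.

Definition two_increasing (m s j : nat) (f : 'I_(m + s) -> 'I_j) : bool :=
  [forall u : 'I_m, forall v : 'I_m,
     (u < v)%N ==> (f (lshift s u) < f (lshift s v))%N] &&
  [forall u : 'I_s, forall v : 'I_s,
     (u < v)%N ==> (f (rshift m u) < f (rshift m v))%N].

Definition sh (m s : nat) : {set 'S_(m + s)} :=
  [set p : 'S_(m + s) | two_increasing p].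

Definition is_qsh (m s j : nat) (f : {ffun 'I_(m + s) -> 'I_j}) : bool :=
  two_increasing f && [forall x, exists u, f u == x].

Definition qsh (m s j : nat) : finType :=
  {f : {ffun 'I_(m + s) -> 'I_j} | is_qsh f}.

Lemma qsh_surj (m s j : nat) (p : qsh m s j) (x : 'I_j) :
  exists u, val p u = x.
Proof.
by have /andP[_ /forallP /(_ x) /existsP[u /eqP]] := valP p; exists u.
Qed.

Definition permuteM (m n : nat) (A : 'M[M]_(m, n)) (p : 'S_m) (q : 'S_n) :
    'M[M]_(m, n) :=
  \matrix_(u, v) A (p^-1%g u) (q^-1%g v).

Fact cpermute_subproof (a : comp) (p : 'S_(nrows a)) (q : 'S_(ncols a)) :
  no_trivial_line (permuteM (cmat a) p q).
Proof.
have /no_trivial_lineP [ra ca] := cmatP a.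
apply/no_trivial_lineP; split=> [u|v].
  by have [v hv] := ra (p^-1%g u); exists (q v); rewrite mxE permK.
by have [u hu] := ca (q^-1%g v); exists (p u); rewrite mxE permK.
Qed.

Definition cpermute (a : comp) (p : 'S_(nrows a)) (q : 'S_(ncols a)) : comp :=
  mkcomp (cpermute_subproof p q).

Definition contractM (m n j k : nat) (A : 'M[M]_(m, n))
    (p : 'I_m -> 'I_j) (q : 'I_n -> 'I_k) : 'M[M]_(j, k) :=
  \matrix_(x, y) \big[mmul/eps]_(u | p u == x) \big[mmul/eps]_(v | q v == y)
    A u v.

Lemma contractM_neq (m n j k : nat) (A : 'M[M]_(m, n))
    (p : 'I_m -> 'I_j) (q : 'I_n -> 'I_k) (u : 'I_m) (v : 'I_n) :
  A u v != eps -> contractM A p q (p u) (q v) != eps.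
Proof.
apply: contra; rewrite mxE (bigD1 u) //= cmM_eq1 => /andP[+ _].
by rewrite (bigD1 v) //= cmM_eq1 => /andP[].
Qed.

Fact ccontract_subproof (a b : comp) (j k : nat)
    (p : qsh (nrows a) (nrows b) j) (q : qsh (ncols a) (ncols b) k) :
  no_trivial_line (contractM (diagM (cmat a) (cmat b)) (val p) (val q)).
Proof.
have /no_trivial_lineP [ra ca] := cdiag_subproof a b.
apply/no_trivial_lineP; split=> [x|y].
  have [u <-] := qsh_surj p x; have [v hv] := ra u.
  by exists (val q v); apply: contractM_neq.
have [v <-] := qsh_surj q y; have [u hu] := ca v.
by exists (val p u); apply: contractM_neq.
Qed.

Definition ccontract (a b : comp) (j k : nat)
    (p : qsh (nrows a) (nrows b) j) (q : qsh (ncols a) (ncols b) k) : comp :=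
  mkcomp (ccontract_subproof p q).

End MatrixCompositions.

Arguments cempty {d}.

Section HopfAlgebras.
Variables (K : comNzRingType) (d : nat).

Local Notation H := {malg K[comp d]}.

Definition comul_basis (a : comp d) : {malg K[(comp d * comp d)%type]} :=
  let us := components a in
  \sum_(0 <= alpha < (size us).+1)
    << (cdiags (take alpha us), cdiags (drop alpha us)) >>.

Lemma comul_basis_cdiags (us : seq (comp d)) :
  {in us, forall u, connected u} ->
  comul_basis (cdiags us) =
    \sum_(0 <= alpha < (size us).+1)
      << (cdiags (take alpha us), cdiags (drop alpha us)) >>.
Proof. by move=> cus; rewrite /comul_basis components_cdiags. Qed.

Definition comul : H -> {malg K[(comp d * comp d)%type]} := lin_ext comul_basis.

Definition counit (x : H) : K := x@_cempty.

Definition shuffle_basis (a b : comp d) : H :=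
  if a == cempty then << b >> else if b == cempty then << a >> else
  \sum_(p in sh (nrows a) (nrows b)) \sum_(q in sh (ncols a) (ncols b))
    << @cpermute d (cdiag a b) p q >>.

(* qsh m s j is empty for j > m + s, so the sums over j, k >= 1 are finite. *)
Definition qshuffle_basis (a b : comp d) : H :=
  if a == cempty then << b >> else if b == cempty then << a >> else
  \sum_(1 <= j < (nrows a + nrows b).+1) \sum_(1 <= k < (ncols a + ncols b).+1)
    \sum_(p : qsh (nrows a) (nrows b) j) \sum_(q : qsh (ncols a) (ncols b) k)
      << ccontract p q >>.

Definition shuffle_hopf : hopf_ops K (comp d) :=
  HopfOps (bilin_ext shuffle_basis) << cempty >> comul counit.

Definition qshuffle_hopf : hopf_ops K (comp d) :=
  HopfOps (bilin_ext qshuffle_basis) << cempty >> comul counit.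

End HopfAlgebras.

(* Main.v *)
Require Import Defs.
From mathcomp Require Import all_boot all_order all_algebra.
From HB Require Import structures.
From mathcomp Require Import all_fingroup.
From mathcomp Require Import finmap monalg.

Set Implicit Arguments.
Unset Strict Implicit.
Unset Printing Implicit Defensive.

Import GRing.Theory Num.Theory.

Local Open Scope ring_scope.
Local Notation comp := Defs.comp.

(** Merging consecutive rows and consecutive columns of a matrix composition
    is Hoffman's exponential, applied to the rows and to the columns at once.
    The isomorphism [exp_map] sends [a] to the sum of the contractions of [a]
    along all nondecreasing surjections [p] of its rows and [q] of its columns,
    with coefficient [weight p * weight q], where [weight p] is the inverse of
    the product of the factorials of the sizes of the fibres of [p].

    Products. Both products are sums over independent choices of a map of the
    rows and a map of the columns, so that it suffices to compare them in one
    direction. There, each side becomes a sum over the words g of length m + s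
    that are sorted on the first m and on the last s letters. If x occurs a_x
    times in the first half of g and b_x times in the second, the coefficient
    of g on the quasi-shuffle side is the product of the 1 / (a_x! b_x!). On
    the shuffle side it is the number of shuffles that sort g, divided by the
    product of the (a_x + b_x)!. That number is a product of binomial
    coefficients, so the two agree. Products of factorials appear here as
    orders of stabilisers in symmetric groups, and the count becomes the unique
    factorisation of a permutation that sorts g into one that stabilises both
    halves and a shuffle ([card_sorting_shuffles]). The identity in one
    direction is [merge_shuffle], and its two-fold use
    [exp_map_shuffle_basis].

    Coproduct. If the contraction of [a] along nondecreasing maps is a diagonal
    sum, then the entries of [a] that are not trivial avoid the off-diagonal
    blocks, hence [a] is a diagonal sum cut at the corresponding place, and the
    maps are direct sums as well. As weights are multiplicative for direct
    sums, the coefficients of the exponential are multiplicative over the cuts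
    of [a] ([exp_basis_splits]).

    Bijectivity and antipodes. A proper merge lowers the number of rows or of
    columns, hence the map is unitriangular ([unitriangular_bij]). For
    antipodes SA and SB, both [exp_map \o SA] and [SB \o exp_map] are
    convolution inverses of [exp_map] on the left, and there is only one such
    inverse because the coalgebra is connected ([left_inverse_uniq]).

    The rational numbers enter only through a ring morphism [rho] from them to
    the scalars. *)

(** * Sorting words *)

Definition nondecr (m l : nat) (f : 'I_m -> 'I_l) : bool :=
  [forall u : 'I_m, forall v : 'I_m, (u <= v)%N ==> (f u <= f v)%N].

Definition incr (m l : nat) (f : 'I_m -> 'I_l) : bool :=
  [forall u : 'I_m, forall v : 'I_m, (u < v)%N ==> (f u < f v)%N].

Definition onto (m l : nat) (f : 'I_m -> 'I_l) : bool :=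
  [forall x, exists u, f u == x].

Lemma nondecrP (m l : nat) (f : 'I_m -> 'I_l) :
  reflect (forall u v : 'I_m, (u <= v)%N -> (f u <= f v)%N) (nondecr f).
Proof.
apply: (iffP idP) => [/forallP h u v|h].
  by move/forallP: (h u) => /(_ v) /implyP.
by apply/forallP => u; apply/forallP => v; apply/implyP/h.
Qed.

Lemma incrP (m l : nat) (f : 'I_m -> 'I_l) :
  reflect (forall u v : 'I_m, (u < v)%N -> (f u < f v)%N) (incr f).
Proof.
apply: (iffP idP) => [/forallP h u v|h].
  by move/forallP: (h u) => /(_ v) /implyP.
by apply/forallP => u; apply/forallP => v; apply/implyP/h.
Qed.

Lemma ontoP (m l : nat) (f : 'I_m -> 'I_l) :
  reflect (forall x, exists u, f u = x) (onto f).
Proof.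
apply: (iffP forallP) => h x; first by have /existsP[u /eqP] := h x; exists u.
by have [u <-] := h x; apply/existsP; exists u.
Qed.

Lemma eq_nondecr (m l : nat) (f g : 'I_m -> 'I_l) :
  f =1 g -> nondecr f = nondecr g.
Proof. by move=> e; do 2!apply: eq_forallb => ?; rewrite !e. Qed.

Lemma eq_incr (m l : nat) (f g : 'I_m -> 'I_l) : f =1 g -> incr f = incr g.
Proof. by move=> e; do 2!apply: eq_forallb => ?; rewrite !e. Qed.

Lemma eq_onto (m l : nat) (f g : 'I_m -> 'I_l) : f =1 g -> onto f = onto g.
Proof.
by move=> e; apply: eq_forallb => ?; apply: eq_existsb => ?; rewrite e.
Qed.

Lemma incr_inj (m l : nat) (f : 'I_m -> 'I_l) : incr f -> injective f.
Proof.
move=> /incrP h u v e; apply: val_inj => /=.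
by case: (ltngtP u v) => // /h; rewrite e ltnn.
Qed.

Lemma incr_mono (m l : nat) (f : 'I_m -> 'I_l) : incr f ->
  forall u v : 'I_m, (f u <= f v)%N = (u <= v)%N.
Proof.
move=> /incrP h u v; have [lt_uv|/h|e] := ltngtP u v.
- exact/ltnW/h.
- by rewrite ltnNge => /negPf.
- by rewrite (val_inj e) leqnn.
Qed.

Lemma incr_nondecr (m l : nat) (f : 'I_m -> 'I_l) : incr f -> nondecr f.
Proof. by move=> /incr_mono h; apply/nondecrP => u v; rewrite h. Qed.

Lemma nondecr_inj_incr (m l : nat) (f : 'I_m -> 'I_l) :
  nondecr f -> injective f -> incr f.
Proof.
move=> /nondecrP h fI; apply/incrP => u v lt_uv.
rewrite ltn_neqAle h ?(ltnW lt_uv) // andbT; apply: contraTneq lt_uv.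
by move=> /val_inj /fI ->; rewrite ltnn.
Qed.

Lemma sorted_enum_ord (m : nat) (r : rel nat) :
  sorted r (iota 0 m) -> sorted (relpre val r) (enum 'I_m).
Proof. by rewrite -sorted_map val_enum_ord. Qed.

(** Sorting has at most one outcome. This identifies words that are only known
    to be rearrangements of each other. *)
Lemma nondecr_perm_eq (m l : nat) (f g : 'I_m -> 'I_l) (s : 'S_m) :
  nondecr f -> nondecr g -> (forall u, g u = f (s u)) -> f =1 g.
Proof.
move=> /nondecrP hf /nondecrP hg e.
suff: [seq val (f u) | u <- enum 'I_m] = [seq val (g u) | u <- enum 'I_m].
  by move/eq_in_map => h u; apply/val_inj/h; rewrite mem_enum.
have sorted_leq (h : 'I_m -> 'I_l) :
    (forall u v : 'I_m, (u <= v)%N -> (h u <= h v)%N) ->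
    sorted leq [seq val (h u) | u <- enum 'I_m] :> bool.
  move=> hh; rewrite sorted_map.
  by apply: sub_sorted (sorted_enum_ord (iota_sorted 0 m)).
apply: (sorted_eq leq_trans anti_leq); rewrite ?sorted_leq //.
rewrite (eq_map (fun u => congr1 val (e u))).
rewrite [X in perm_eq _ X](map_comp (fun u => val (f u)) s); apply: perm_map.
apply: uniq_perm; first exact: enum_uniq.
  by rewrite (map_inj_uniq (@perm_inj _ s)) enum_uniq.
move=> u; rewrite mem_enum; symmetry; apply/mapP; exists (s^-1%g u).
  by rewrite mem_enum.
by rewrite permKV.
Qed.

(** An increasing word is the ordered enumeration of its set of letters. *)
Lemma incr_image_eq (j l : nat) (f g : 'I_j -> 'I_l) :
  incr f -> incr g -> codom f =i codom g -> f =1 g.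
Proof.
move=> /incrP hf /incrP hg e.
suff: [seq val (f u) | u <- enum 'I_j] = [seq val (g u) | u <- enum 'I_j].
  by move/eq_in_map => h u; apply/val_inj/h; rewrite mem_enum.
have sorted_ltn (h : 'I_j -> 'I_l) :
    (forall u v : 'I_j, (u < v)%N -> (h u < h v)%N) ->
    sorted ltn [seq val (h u) | u <- enum 'I_j] :> bool.
  move=> hh; rewrite sorted_map.
  by apply: sub_sorted (sorted_enum_ord (iota_ltn_sorted 0 j)).
apply: (irr_sorted_eq ltn_trans ltnn); rewrite ?sorted_ltn //.
move=> x; rewrite !(map_comp val); apply: eq_mem_map => y.
by rewrite -!codomE.
Qed.

Lemma sort_perm (m l : nat) (f : 'I_m -> 'I_l) :
  exists s : 'S_m, nondecr (fun u => f (s u)).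
Proof.
pose r := relpre (val : 'I_l -> nat) leq.
pose t := [tuple f u | u < m].
have /tuple_permP[s es] : perm_eq (sort r t) t by rewrite perm_sort.
exists s; apply/nondecrP => u v le_uv.
have sz : size (sort r t) = m by rewrite size_sort size_tuple.
have r_tr : transitive r by move=> ? ? ?; apply: leq_trans.
have srt : sorted r (sort r t) by apply: sort_sorted => ? ?; apply: leq_total.
have nthE (w : 'I_m) : nth (f u) (sort r t) w = f (s w).
  by rewrite es -tnth_nth !tnth_mktuple.
have := sorted_leq_nth r_tr (fun x => leqnn x) (f u) srt.
by move=> /(_ u v); rewrite !inE sz !ltn_ord !nthE /r /=; apply.
Qed.

Lemma perm_nondecr1 (m : nat) (s : 'S_m) : nondecr s -> s = 1%g.
Proof.
move=> hs; apply/permP => u; rewrite perm1.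
by apply: esym; apply: (@nondecr_perm_eq m m id s s) => //; apply/nondecrP.
Qed.

(** * Stabilisers *)

Definition stab (m l : nat) (f : 'I_m -> 'I_l) : {set 'S_m} :=
  [set s : 'S_m | [forall u, f (s u) == f u]].

Lemma stabP (m l : nat) (f : 'I_m -> 'I_l) (s : 'S_m) :
  reflect (forall u, f (s u) = f u) (s \in stab f).
Proof. by rewrite inE; apply: (iffP forallP) => h u; apply/eqP. Qed.

Lemma stab_gt0 (m l : nat) (f : 'I_m -> 'I_l) : (0 < #|stab f|)%N.
Proof.
by apply/card_gt0P; exists 1%g; apply/stabP => u; rewrite perm1.
Qed.

Lemma eq_stab (m l k : nat) (f : 'I_m -> 'I_l) (g : 'I_m -> 'I_k) :
  (forall u v, (f u == f v) = (g u == g v)) -> stab f = stab g.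
Proof. by move=> e; apply/setP => s; rewrite !inE; apply: eq_forallb. Qed.

Lemma stab_inj (m l : nat) (f : 'I_m -> 'I_l) : injective f ->
  stab f = [set 1%g].
Proof.
move=> fI; apply/setP => s; rewrite in_set1; apply/stabP/eqP => [h|-> u].
  by apply/permP => u; rewrite perm1; apply/fI/h.
by rewrite perm1.
Qed.

Lemma card_stab_perm (m l : nat) (f : 'I_m -> 'I_l) (t : 'S_m) :
  #|stab (fun u => f (t u))| = #|stab f|.
Proof.
rewrite -(card_imset _ (conjg_inj t)); apply: eq_card => s.
apply/imsetP/idP => [[r /stabP hr ->]|/stabP hs].
  apply/stabP => u; rewrite /conjg !permM.
  by have := hr (t^-1%g u); rewrite permKV.
exists (s ^ t^-1)%g; last by rewrite -conjgM mulVg conjg1.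
by apply/stabP => u; rewrite /conjg !permM invgK permKV hs.
Qed.

(** * Words in two halves and shuffles *)

Definition glue (m s : nat) (T : Type) (f : 'I_m -> T) (g : 'I_s -> T)
    (i : 'I_(m + s)) : T :=
  match split i with inl u => f u | inr v => g v end.

Definition dsum (m s j k : nat) (f : 'I_m -> 'I_j) (g : 'I_s -> 'I_k) :
    'I_(m + s) -> 'I_(j + k) :=
  glue (fun u => lshift k (f u)) (fun v => rshift j (g v)).

Lemma glue_lshift (m s : nat) (T : Type) (f : 'I_m -> T) (g : 'I_s -> T) u :
  glue f g (lshift s u) = f u.
Proof.
rewrite /glue; case: split_ordP => v; first by move/lshift_inj->.
by move/eqP; rewrite eq_lrshift.
Qed.

Lemma glue_rshift (m s : nat) (T : Type) (f : 'I_m -> T) (g : 'I_s -> T) v :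
  glue f g (rshift m v) = g v.
Proof.
rewrite /glue; case: split_ordP => u; last by move/rshift_inj->.
by move/eqP; rewrite eq_rlshift.
Qed.

Lemma dsum_lshift (m s j k : nat) (f : 'I_m -> 'I_j) (g : 'I_s -> 'I_k) u :
  dsum f g (lshift s u) = lshift k (f u).
Proof. exact: glue_lshift. Qed.

Lemma dsum_rshift (m s j k : nat) (f : 'I_m -> 'I_j) (g : 'I_s -> 'I_k) v :
  dsum f g (rshift m v) = rshift j (g v).
Proof. exact: glue_rshift. Qed.

Lemma eq_shift (m s : nat) (T : Type) (f g : 'I_(m + s) -> T) :
  (forall u, f (lshift s u) = g (lshift s u)) ->
  (forall v, f (rshift m v) = g (rshift m v)) -> f =1 g.
Proof. by move=> hl hr i; case: (split_ordP i) => k ->. Qed.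

Lemma dsum_inj (m s j k : nat) (f : 'I_m -> 'I_j) (g : 'I_s -> 'I_k) :
  injective f -> injective g -> injective (dsum f g).
Proof.
move=> fI gI x y.
case: (split_ordP x) => u ->; case: (split_ordP y) => v ->;
  rewrite ?(dsum_lshift, dsum_rshift).
- by move=> /lshift_inj /fI ->.
- by move/eqP; rewrite eq_lrshift.
- by move/eqP; rewrite eq_rlshift.
- by move=> /rshift_inj /gI ->.
Qed.

Definition dperm (m s : nat) (t1 : 'S_m) (t2 : 'S_s) : 'S_(m + s) :=
  perm (dsum_inj (@perm_inj _ t1) (@perm_inj _ t2)).

Lemma dperm_lshift (m s : nat) (t1 : 'S_m) (t2 : 'S_s) u :
  dperm t1 t2 (lshift s u) = lshift s (t1 u).
Proof. by rewrite permE dsum_lshift. Qed.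

Lemma dperm_rshift (m s : nat) (t1 : 'S_m) (t2 : 'S_s) v :
  dperm t1 t2 (rshift m v) = rshift m (t2 v).
Proof. by rewrite permE dsum_rshift. Qed.

Lemma dperm_stab (m s l : nat) (g : 'I_(m + s) -> 'I_l) t1 t2 :
  t1 \in stab (fun u => g (lshift s u)) ->
  t2 \in stab (fun v => g (rshift m v)) -> dperm t1 t2 \in stab g.
Proof.
move=> /stabP h1 /stabP h2; apply/stabP; apply: eq_shift => u.
  by rewrite dperm_lshift h1.
by rewrite dperm_rshift h2.
Qed.

Lemma stabV (m l : nat) (f : 'I_m -> 'I_l) (s : 'S_m) :
  s \in stab f -> (s^-1)%g \in stab f.
Proof. by move=> /stabP h; apply/stabP => u; rewrite -h permKV. Qed.

Lemma shP (m s : nat) (p : 'S_(m + s)) :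
  (p \in sh m s) =
  incr (fun u => p (lshift s u)) && incr (fun v => p (rshift m v)).
Proof. by rewrite inE. Qed.

(** The permutations that sort [g] form one coset of its stabiliser. *)
Lemma card_sorting_perms (m l : nat) (g : 'I_m -> 'I_l) :
  #|[set t : 'S_m | nondecr (fun x => g ((t^-1)%g x))]| = #|stab g|.
Proof.
have [t0 ht0] := sort_perm g.
rewrite -(card_imset (mem (stab g)) (mulIg (t0^-1)%g)); apply: eq_card => t.
rewrite inE; apply/idP/imsetP => [ht|[r /stabP hr ->]].
  exists (t * t0)%g; last by rewrite mulgK.
  have e : (fun x => g (t^-1 x)%g) =1 (fun x => g (t0 x)).
    by apply: (@nondecr_perm_eq _ _ _ _ (t0 * t)%g) => // u; rewrite permM permK.
  by apply/stabP => u; rewrite permM -e permK.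
rewrite (@eq_nondecr _ _ _ (fun x => g (t0 x))) // => x.
by rewrite invMg invgK permM -(hr (r^-1 _)%g) permKV.
Qed.

(** A permutation that sorts [g] is, in exactly one way, a permutation that
    stabilises each half followed by a shuffle. In terms of factorials, this
    counts the sorting shuffles by a product of binomial coefficients. *)
Lemma card_sorting_shuffles (m s l : nat) (g : 'I_(m + s) -> 'I_l) :
  nondecr (fun u => g (lshift s u)) -> nondecr (fun v => g (rshift m v)) ->
  (#|[set p in sh m s | nondecr (fun x => g ((p^-1)%g x))]| *
    (#|stab (fun u => g (lshift s u))| * #|stab (fun v => g (rshift m v))|))%N
  = #|stab g|.
Proof.
move=> gl gr; rewrite -(card_sorting_perms g) -!cardsX.
set X := setX _ _.
pose F (x : 'S_(m + s) * ('S_m * 'S_s)) := (dperm x.2.1 x.2.2 * x.1)%g.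
have FI : {in X &, injective F}.
  move=> [p [t1 t2]] [p' [t1' t2']]; rewrite !inE /=.
  move=> /andP[/andP[/andP[pl pr] _] _] /andP[/andP[/andP[pl' pr'] _] _].
  rewrite /F /= => /permP e.
  have el : (fun u => p (lshift s u)) =1 (fun u => p' (lshift s u)).
    apply: (@nondecr_perm_eq _ _ _ _ (t1'^-1 * t1)%g) => [||u].
    - exact: incr_nondecr.
    - exact: incr_nondecr.
    have := e (lshift s (t1'^-1 u)%g).
    by rewrite !permM !dperm_lshift permKV => <-.
  have er : (fun u => p (rshift m u)) =1 (fun u => p' (rshift m u)).
    apply: (@nondecr_perm_eq _ _ _ _ (t2'^-1 * t2)%g) => [||u].
    - exact: incr_nondecr.
    - exact: incr_nondecr.
    have := e (rshift m (t2'^-1 u)%g).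
    by rewrite !permM !dperm_rshift permKV => <-.
  have {el er} ep : p = p' by apply/permP; apply: eq_shift.
  subst p'; congr (_, (_, _)); apply/permP => u.
    have := e (lshift s u); rewrite !permM !dperm_lshift.
    by move/perm_inj/lshift_inj.
  have := e (rshift m u); rewrite !permM !dperm_rshift.
  by move/perm_inj/rshift_inj.
rewrite -(card_in_imset FI); apply: eq_card => t; rewrite inE.
apply/imsetP/idP => [[[p [t1 t2]]]|ht].
  rewrite !in_setX inE /= => /andP[/andP[_ hp] /andP[h1 h2]] ->.
  rewrite (@eq_nondecr _ _ _ (fun x => g ((p^-1)%g x))) // => x.
  have /stabP hd := stabV (dperm_stab h1 h2).
  by rewrite /F /= invMg permM hd.
(* Sorting the positions that t assigns to each half leaves a shuffle. *)
have [s1 hs1] := sort_perm (fun u => t (lshift s u)).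
have [s2 hs2] := sort_perm (fun u => t (rshift m u)).
have gE x : g x = g ((t^-1)%g (t x)) by rewrite permK.
have st1 : s1 \in stab (fun u => g (lshift s u)).
  apply/stabP => u; apply/esym.
  apply: (@nondecr_perm_eq _ _ (fun u => g (lshift s u))
    (fun u => g (lshift s (s1 u))) s1) => //.
  apply/nondecrP => a b le_ab; rewrite !(gE (lshift _ _)).
  by move/nondecrP: ht; apply; move/nondecrP: hs1; apply.
have st2 : s2 \in stab (fun u => g (rshift m u)).
  apply/stabP => u; apply/esym.
  apply: (@nondecr_perm_eq _ _ (fun u => g (rshift m u))
    (fun u => g (rshift m (s2 u))) s2) => //.
  apply/nondecrP => a b le_ab; rewrite !(gE (rshift _ _)).
  by move/nondecrP: ht; apply; move/nondecrP: hs2; apply.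
exists ((dperm s1 s2 * t)%g, ((s1^-1)%g, (s2^-1)%g)); last first.
  apply/permP; rewrite /F /=; apply: eq_shift => u; rewrite !permM.
    by rewrite !dperm_lshift permKV.
  by rewrite !dperm_rshift permKV.
rewrite !in_setX !stabV // !andbT inE shP; apply/andP; split.
  apply/andP; split; apply: nondecr_inj_incr.
  - apply/nondecrP => a b le_ab; rewrite !permM !dperm_lshift.
    by move/nondecrP: hs1; apply.
  - by move=> a b /perm_inj/lshift_inj.
  - apply/nondecrP => a b le_ab; rewrite !permM !dperm_rshift.
    by move/nondecrP: hs2; apply.
  - by move=> a b /perm_inj/rshift_inj.
rewrite (@eq_nondecr _ _ _ (fun x => g (t^-1 x)%g)) // => x.
have /stabP hd := stabV (dperm_stab st1 st2).
by rewrite invMg permM hd.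
Qed.

(** Shuffles are increasing on each half, hence pull sorted words back to words
    with sorted halves. The other words do not contribute to the product. *)
Lemma sorting_shuffle_halves (m s l : nat) (g : 'I_(m + s) -> 'I_l) p :
  p \in sh m s -> nondecr (fun x => g ((p^-1)%g x)) ->
  nondecr (fun u => g (lshift s u)) && nondecr (fun v => g (rshift m v)).
Proof.
rewrite shP => /andP[hl hr] /nondecrP h; apply/andP; split.
  apply/nondecrP => u v le_uv; have := h (p (lshift s u)) (p (lshift s v)).
  by rewrite !permK; apply; rewrite (incr_mono hl).
apply/nondecrP => u v le_uv; have := h (p (rshift m u)) (p (rshift m v)).
by rewrite !permK; apply; rewrite (incr_mono hr).
Qed.

Lemma nondecr_dsum (m s j k : nat) (f : 'I_m -> 'I_j) (g : 'I_s -> 'I_k) :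
  nondecr (dsum f g) = nondecr f && nondecr g.
Proof.
apply/nondecrP/andP => [h|[/nondecrP hf /nondecrP hg]].
  split; apply/nondecrP => u v le_uv.
    by have := h (lshift s u) (lshift s v); rewrite !dsum_lshift; apply.
  have := h (rshift m u) (rshift m v).
  by rewrite !dsum_rshift /= !leq_add2l; apply.
move=> x y; case: (split_ordP x) => u ->; case: (split_ordP y) => v ->;
  rewrite ?(dsum_lshift, dsum_rshift) /=.
- exact: hf.
- by move=> _; apply: leq_trans (ltnW (ltn_ord _)) (leq_addr _ _).
- by move=> h; have := leq_ltn_trans h (ltn_ord v); rewrite ltnNge leq_addr.
- by rewrite !leq_add2l; apply: hg.
Qed.

Lemma onto_dsum (m s j k : nat) (f : 'I_m -> 'I_j) (g : 'I_s -> 'I_k) :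
  onto (dsum f g) = onto f && onto g.
Proof.
apply/ontoP/andP => [h|[/ontoP hf /ontoP hg] x]; last first.
  case: (split_ordP x) => y ->.
    by have [u <-] := hf y; exists (lshift s u); rewrite dsum_lshift.
  by have [u <-] := hg y; exists (rshift m u); rewrite dsum_rshift.
split; apply/ontoP => x.
  have [u] := h (lshift k x); case: (split_ordP u) => v ->.
    by rewrite dsum_lshift => /lshift_inj; exists v.
  by rewrite dsum_rshift => /eqP; rewrite eq_rlshift.
have [u] := h (rshift j x); case: (split_ordP u) => v ->.
  by rewrite dsum_lshift => /eqP; rewrite eq_lrshift.
by rewrite dsum_rshift => /rshift_inj; exists v.
Qed.

(** The word [dsum f g] is sorted and its halves have no letter in common, so
    the identity is the only shuffle that sorts it and the count of
    [card_sorting_shuffles] reduces to one. *)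
Lemma card_stab_dsum (m s j k : nat) (f : 'I_m -> 'I_j) (g : 'I_s -> 'I_k) :
  nondecr f -> nondecr g ->
  #|stab (dsum f g)| = (#|stab f| * #|stab g|)%N.
Proof.
move=> hf hg.
have hl : (fun u => dsum f g (lshift s u)) =1 (fun u => lshift k (f u)).
  exact: dsum_lshift.
have hr : (fun u => dsum f g (rshift m u)) =1 (fun u => rshift j (g u)).
  exact: dsum_rshift.
have hd : nondecr (dsum f g) by rewrite nondecr_dsum hf hg.
have [hdl hdr] : nondecr (fun u => dsum f g (lshift s u)) /\
    nondecr (fun v => dsum f g (rshift m v)).
  split; apply/nondecrP => u v le_uv; move/nondecrP: hd; apply => //=.
  by rewrite leq_add2l.
rewrite -card_sorting_shuffles //.
have -> : stab (fun u => dsum f g (lshift s u)) = stab f.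
  by apply: eq_stab => u v; rewrite !hl eq_lshift.
have -> : stab (fun u => dsum f g (rshift m u)) = stab g.
  by apply: eq_stab => u v; rewrite !hr eq_rshift.
suff -> : [set p in sh m s | nondecr (fun x => dsum f g ((p^-1)%g x))] = [set 1%g].
  by rewrite cards1 mul1n.
apply/setP => p; rewrite in_set1 inE shP; apply/andP/eqP => [[/andP[pl pr] hp]|->].
  have e : dsum f g =1 (fun x => dsum f g ((p^-1)%g x)).
    exact: (@nondecr_perm_eq _ _ _ _ (p^-1)%g).
  have {}e x : dsum f g (p x) = dsum f g x by rewrite e permK.
  apply: perm_nondecr1.
  have pL u : exists v, p (lshift s u) = lshift s v.
    have := e (lshift s u); case: (split_ordP (p (lshift s u))) => v ->.
      by exists v.
    by rewrite dsum_lshift dsum_rshift => /eqP; rewrite eq_rlshift.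
  have pR u : exists v, p (rshift m u) = rshift m v.
    have := e (rshift m u); case: (split_ordP (p (rshift m u))) => v ->.
      by rewrite dsum_lshift dsum_rshift => /eqP; rewrite eq_lrshift.
    by exists v.
  apply/nondecrP => x y.
  case: (split_ordP x) => u ->; case: (split_ordP y) => v ->.
  - by rewrite (incr_mono pl).
  - have [a ->] := pL u; have [b ->] := pR v => _ /=.
    by apply: leq_trans (ltnW (ltn_ord _)) (leq_addr _ _).
  - move=> /= h; have := leq_ltn_trans h (ltn_ord v).
    by rewrite ltnNge leq_addr.
  - by rewrite (incr_mono pr) /= leq_add2l.
split; last by rewrite (@eq_nondecr _ _ _ (dsum f g)) // => x; rewrite invg1 perm1.
apply/andP; split; apply/incrP => u v; rewrite !perm1 //=.
by rewrite ltn_add2l.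
Qed.

(** * Merging in one direction *)

Definition fcomp (m j l : nat) (r : 'I_j -> 'I_l) (p : 'I_m -> 'I_j) :
    {ffun 'I_m -> 'I_l} := [ffun u => r (p u)].

Lemma onto_leq (m j : nat) (p : 'I_m -> 'I_j) : onto p -> (j <= m)%N.
Proof.
move=> /ontoP h; rewrite -[j]card_ord -[m]card_ord.
apply: leq_trans (leq_image_card p 'I_m); apply/subset_leq_card/subsetP.
by move=> x _; have [u <-] := h x; apply: image_f.
Qed.

Lemma big_ord_vanish (V : nmodType) (N N' : nat) (F : nat -> V) :
  (N <= N')%N -> (forall j, (N <= j)%N -> F j = 0) ->
  \sum_(j < N') F j = \sum_(j < N) F j.
Proof.
move=> le_N h; rewrite !(big_ord_widen _ F le_N) big_mkcond /=.
rewrite [RHS]big_mkcond /=; apply: eq_bigr => j _.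
by case: ltnP => // /h.
Qed.

Lemma big_glue (V : nmodType) (m s : nat) (T : finType)
    (F : {ffun 'I_(m + s) -> T} -> V) :
  \sum_g F g = \sum_(g1 : {ffun 'I_m -> T}) \sum_(g2 : {ffun 'I_s -> T})
     F [ffun i => glue g1 g2 i].
Proof.
rewrite pair_bigA /=.
apply: (reindex (fun x : {ffun 'I_m -> T} * {ffun 'I_s -> T} =>
  [ffun i => glue x.1 x.2 i])).
exists (fun g : {ffun 'I_(m + s) -> T} =>
  ([ffun u => g (lshift s u)], [ffun v => g (rshift m v)])).
  move=> [g1 g2] _ /=; congr (_, _); apply/ffunP => u; rewrite !ffunE.
    exact: glue_lshift.
  exact: glue_rshift.
move=> g _; apply/ffunP => i; rewrite ffunE.
case: (split_ordP i) => u ->.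
  by rewrite glue_lshift ffunE.
by rewrite glue_rshift ffunE.
Qed.

(** The middle object has as many elements as the image of [g], and the
    injection is the ordered enumeration of that image. *)
Lemma epi_mono (m l : nat) (g : {ffun 'I_m -> 'I_l}) :
  exists x : {j : 'I_m.+1 & ({ffun 'I_m -> 'I_j} * {ffun 'I_j -> 'I_l})%type},
  forall y : {j : 'I_m.+1 & ({ffun 'I_m -> 'I_j} * {ffun 'I_j -> 'I_l})%type},
            (onto (tagged y).1 && incr (tagged y).2 &&
             (fcomp (tagged y).2 (tagged y).1 == g)) = (y == x).
Proof.
pose D := [set g u | u in 'I_m].
have gD u : g u \in D by apply: imset_f.
have ltD : (#|D| < m.+1)%N by rewrite ltnS -[m in (_ <= m)%N]card_ord leq_imset_card.
pose j0 : 'I_m.+1 := Ordinal ltD.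
(* [enum_val] need not be increasing, so it is sorted by t. *)
have [t ht] := sort_perm (fun x : 'I_j0 => enum_val x : 'I_l).
pose r0 : {ffun 'I_j0 -> 'I_l} := [ffun x => enum_val (t x)].
pose p0 : {ffun 'I_m -> 'I_j0} :=
  [ffun u => (t^-1)%g (enum_rank_in (gD u) (g u))].
have p0onto : onto p0.
  apply/ontoP => x; have /imsetP[u _ e] := enum_valP (t x).
  exists u; apply: (@perm_inj _ t); rewrite ffunE permKV.
  by apply: enum_val_inj; rewrite enum_rankK_in.
have r0incr : incr r0.
  apply: nondecr_inj_incr => [|x y]; last first.
    by rewrite !ffunE => /enum_val_inj/perm_inj.
  by rewrite (eq_nondecr (ffunE _)).
have e0 : fcomp r0 p0 = g.
  by apply/ffunP => u; rewrite !ffunE permKV enum_rankK_in.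
have imD j (p : {ffun 'I_m -> 'I_j}) (r : {ffun 'I_j -> 'I_l}) :
    onto p -> fcomp r p = g -> codom r =i D.
  move=> /ontoP po e x; apply/codomP/imsetP => [[y ->]|[u _ ->]].
    by have [u <-] := po y; exists u; rewrite // -e ffunE.
  by exists (p u); rewrite -e ffunE.
exists (existT _ j0 (p0, r0)) => y.
apply/andP/eqP => [|->]; last by rewrite /= p0onto r0incr e0.
case: y => j [p r] /= [/andP[po ri] /eqP e].
have ej : j = j0.
  apply: val_inj => /=; rewrite -(eq_card (imD _ _ _ po e)).
  by rewrite card_codom ?card_ord //; apply: incr_inj.
subst j.
have er : r = r0.
  apply/ffunP; apply: incr_image_eq => // x.
  by rewrite (imD _ _ _ po e) (imD _ _ _ p0onto e0).
subst r; suff -> : p = p0 by [].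
apply/ffunP => u; apply: (incr_inj r0incr).
by have := congr1 (fun f : {ffun _ -> _} => f u) (etrans e (esym e0)); rewrite !ffunE.
Qed.

Lemma big_epi_mono (V : nmodType) (m l : nat) (G : {ffun 'I_m -> 'I_l} -> V) :
  \sum_(j < m.+1) \sum_(p : {ffun 'I_m -> 'I_j} | onto p)
     \sum_(r : {ffun 'I_j -> 'I_l} | incr r) G (fcomp r p) = \sum_g G g.
Proof.
under eq_bigr do rewrite pair_big_dep /=.
rewrite sig_big_dep /=.
rewrite (partition_big (fun y :
  {j : 'I_m.+1 & ({ffun 'I_m -> 'I_j} * {ffun 'I_j -> 'I_l})%type} =>
  fcomp (tagged y).2 (tagged y).1) xpredT) //=.
apply: eq_bigr => g _; have [x hx] := epi_mono g.
rewrite (eq_bigl (pred1 x)) => [|y]; last first.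
  by apply: etrans (hx y) _.
rewrite big_pred1_eq; have := hx x; rewrite eqxx => /andP[_ /eqP ->] //.
Qed.

Section Weights.
Variables (K : comNzRingType) (rho : {rmorphism rat -> K}).

(** For nondecreasing [f], the inverse of the product of the factorials of the
    sizes of the fibres of [f]. Writing this product as the order of a
    stabiliser turns identities between factorials into bijections between sets
    of permutations. *)
Definition weight (m l : nat) (f : 'I_m -> 'I_l) : K :=
  if nondecr f then rho #|stab f|%:R^-1 else 0.

Lemma eq_weight (m l : nat) (f g : 'I_m -> 'I_l) :
  f =1 g -> weight f = weight g.
Proof.
move=> e; rewrite /weight (eq_nondecr e) (@eq_stab _ _ _ f g) // => u v.
by rewrite !e.
Qed.

Lemma weight_incr (m l : nat) (f : 'I_m -> 'I_l) : incr f -> weight f = 1.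
Proof.
move=> hf; rewrite /weight incr_nondecr // stab_inj; last exact: incr_inj.
by rewrite cards1 invr1 rmorph1.
Qed.

Lemma weight_comp (m j l : nat) (r : 'I_j -> 'I_l) (p : 'I_m -> 'I_j) :
  incr r -> weight (fun u => r (p u)) = weight p.
Proof.
move=> hr; rewrite /weight; congr (if _ then _ else _).
  by apply: eq_forallb => u; apply: eq_forallb => v; rewrite (incr_mono hr).
by rewrite (@eq_stab _ _ _ _ p) // => u v; rewrite (inj_eq (incr_inj hr)).
Qed.

Lemma weight_dsum (m s j k : nat) (f : 'I_m -> 'I_j) (g : 'I_s -> 'I_k) :
  weight (dsum f g) = weight f * weight g.
Proof.
rewrite /weight nondecr_dsum; case hf: (nondecr f); last by rewrite mul0r.
case hg: (nondecr g); last by rewrite mulr0.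
by rewrite card_stab_dsum // natrM invfM rmorphM.
Qed.

Lemma weight_shuffles (m s l : nat) (g : 'I_(m + s) -> 'I_l) :
  \sum_(p in sh m s) weight (fun x => g ((p^-1)%g x)) =
  weight (fun u => g (lshift s u)) * weight (fun v => g (rshift m v)).
Proof.
rewrite {1}/weight -big_mkcondr /=.
have [/andP[gl gr]|] := boolP (nondecr (fun u => g (lshift s u)) &&
  nondecr (fun v => g (rshift m v))); last first.
  rewrite negb_and => h; rewrite big1 => [|p /andP[hp hg]].
    rewrite /weight; case/orP: h => /negPf ->; first by rewrite mul0r.
    by rewrite mulr0.
  by move: h; rewrite -negb_and (sorting_shuffle_halves hp hg).
under eq_bigr => p _ do rewrite card_stab_perm.
rewrite (eq_bigl (fun p => p \in [set p in sh m s |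
  nondecr (fun x => g ((p^-1)%g x))])); last by move=> p; rewrite inE.
rewrite sumr_const /weight gl gr -rmorphM -rmorphMn.
congr (rho _); have := card_sorting_shuffles gl gr.
set N := #|_|; set a := #|stab _|; set b := #|stab _|; set c := #|stab _|.
move=> <-; have [Npos ab] : (0 < N)%N /\ (0 < a * b)%N.
  by apply/andP; rewrite -muln_gt0 (card_sorting_shuffles gl gr) stab_gt0.
rewrite -mulr_natl natrM invfM mulVKf; last by rewrite pnatr_eq0 -lt0n.
by rewrite natrM invfM.
Qed.

(** Hoffman's exponential on words, with [F j p] in the place of the word
    that results from the merge [p]. Taking values in a module lets the summand
    be a sum over merges of another word. *)
Definition merge_sum (V : lmodType K) (m : nat)
    (F : forall j, {ffun 'I_m -> 'I_j} -> V) : V :=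
  \sum_(j < m.+1) \sum_(p : {ffun 'I_m -> 'I_j} | onto p) weight p *: F j p.

Lemma merge_sum_linear (V W : lmodType K) (f : {linear V -> W}) (m : nat)
    (F : forall j, {ffun 'I_m -> 'I_j} -> V) :
  f (merge_sum F) = merge_sum (fun j p => f (F j p)).
Proof.
rewrite linear_sum; apply: eq_bigr => j _; rewrite linear_sum.
by apply: eq_bigr => p _; rewrite linearZ.
Qed.

Lemma eq_merge_sum (V : lmodType K) (m : nat)
    (F G : forall j, {ffun 'I_m -> 'I_j} -> V) :
  (forall j (p : {ffun 'I_m -> 'I_j}), onto p -> F j p = G j p) ->
  merge_sum F = merge_sum G.
Proof. by move=> e; do 2!apply: eq_bigr => ? ?; rewrite e. Qed.

Lemma exchange_merge_sum (V : lmodType K) (m n : nat)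
    (F : forall j, {ffun 'I_m -> 'I_j} -> forall k, {ffun 'I_n -> 'I_k} -> V) :
  merge_sum (fun j p => merge_sum (fun k q => F j p k q)) =
  merge_sum (fun k q => merge_sum (fun j p => F j p k q)).
Proof.
rewrite /merge_sum.
transitivity (\sum_(j < m.+1) \sum_(k < n.+1)
  \sum_(p : {ffun 'I_m -> 'I_j} | onto p)
  \sum_(q : {ffun 'I_n -> 'I_k} | onto q) (weight p * weight q) *: F j p k q).
  apply: eq_bigr => j _; rewrite exchange_big /=; apply: eq_bigr => p _.
  rewrite scaler_sumr; apply: eq_bigr => k _; rewrite scaler_sumr.
  by apply: eq_bigr => q _; rewrite scalerA.
rewrite exchange_big; apply: eq_bigr => k _ /=.
under eq_bigr do rewrite exchange_big /=.
rewrite exchange_big; apply: eq_bigr => q _ /=.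
rewrite scaler_sumr; apply: eq_bigr => j _; rewrite scaler_sumr.
by apply: eq_bigr => p _; rewrite scalerA mulrC.
Qed.

Lemma exchange_merge_sum_big (V : lmodType K) (m : nat) (I : Type) (r : seq I)
    (P : pred I) (F : I -> forall j, {ffun 'I_m -> 'I_j} -> V) :
  \sum_(i <- r | P i) merge_sum (F i) =
  merge_sum (fun j p => \sum_(i <- r | P i) F i j p).
Proof.
rewrite exchange_big; apply: eq_bigr => j _; rewrite exchange_big.
by apply: eq_bigr => p _; rewrite scaler_sumr.
Qed.

(** The common form of the two sides of [merge_shuffle]. The weights vanish
    unless both halves of [g] are sorted. *)
Definition halves_sum (V : lmodType K) (m s : nat)
    (F : forall l, {ffun 'I_(m + s) -> 'I_l} -> V) : V :=
  \sum_(l < (m + s).+1) \sum_(g : {ffun 'I_(m + s) -> 'I_l} | onto g)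
    (weight (fun u => g (lshift s u)) * weight (fun v => g (rshift m v))) *: F l g.

Lemma shuffle_merge_halves (V : lmodType K) (m s : nat)
    (F : forall l, {ffun 'I_(m + s) -> 'I_l} -> V) :
  \sum_(t in sh m s) merge_sum (fun l p => F l (fcomp p t)) = halves_sum F.
Proof.
rewrite exchange_big; apply: eq_bigr => l _ /=.
transitivity (\sum_(t in sh m s) \sum_(g : {ffun 'I_(m + s) -> 'I_l} | onto g)
    weight (fun x => g ((t^-1)%g x)) *: F l g).
  apply: eq_bigr => t _.
  rewrite [RHS](reindex (fun p : {ffun 'I_(m + s) -> 'I_l} => fcomp p t)) /=.
    apply: eq_big => [p|p _].
      apply/ontoP/ontoP => h x; have [u <-] := h x; last first.
        by exists (t u); rewrite ffunE.
      by exists ((t^-1)%g u); rewrite ffunE permKV.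
    by congr (_ *: _); apply: eq_weight => x; rewrite ffunE permKV.
  exists (fun g : {ffun 'I_(m + s) -> 'I_l} => fcomp g (t^-1)%g) => p _.
    by apply/ffunP => u; rewrite !ffunE permKV.
  by apply/ffunP => u; rewrite !ffunE permK.
rewrite exchange_big; apply: eq_bigr => g _ /=.
by rewrite -scaler_suml weight_shuffles.
Qed.

(** A sorted word is an increasing word after a merge, and the injection does
    not change the stabiliser, hence neither the weight. *)
Lemma merge_sum_epi_mono (V : lmodType K) (m l : nat)
    (G : {ffun 'I_m -> 'I_l} -> V) :
  merge_sum (fun j p => \sum_(r : {ffun 'I_j -> 'I_l} | incr r) G (fcomp r p))
  = \sum_(g : {ffun 'I_m -> 'I_l}) weight g *: G g.
Proof.
rewrite -big_epi_mono; apply: eq_bigr => j _; apply: eq_bigr => p _.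
rewrite scaler_sumr; apply: eq_bigr => r hr; congr (_ *: _).
by rewrite -(weight_comp p hr); apply: eq_weight => u; rewrite ffunE.
Qed.

Lemma is_qshE (m s j : nat) (f : {ffun 'I_(m + s) -> 'I_j}) :
  is_qsh f = [&& incr (fun u => f (lshift s u)), incr (fun v => f (rshift m v))
               & onto f].
Proof. by rewrite andbA. Qed.

Lemma merge_qshuffle_halves (V : lmodType K) (m s : nat)
    (F : forall l, {ffun 'I_(m + s) -> 'I_l} -> V) :
  merge_sum (fun j1 (p1 : {ffun 'I_m -> 'I_j1}) =>
    merge_sum (fun j2 (p2 : {ffun 'I_s -> 'I_j2}) =>
      \sum_(l < (j1 + j2).+1)
        \sum_(r : {ffun 'I_(j1 + j2) -> 'I_l} | is_qsh r)
          F l (fcomp r (dsum p1 p2)))) = halves_sum F.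
Proof.
(* For onto p1 and p2, the map r is onto exactly when its composite with
   dsum p1 p2 is, so this condition depends only on the two halves. *)
pose G l (g1 : {ffun 'I_m -> 'I_l}) (g2 : {ffun 'I_s -> 'I_l}) : V :=
  let g := [ffun i => glue g1 g2 i] in if onto g then F l g else 0.
transitivity (\sum_(l < (m + s).+1)
  merge_sum (fun j1 (p1 : {ffun 'I_m -> 'I_j1}) =>
    \sum_(r1 : {ffun 'I_j1 -> 'I_l} | incr r1)
    merge_sum (fun j2 (p2 : {ffun 'I_s -> 'I_j2}) =>
      \sum_(r2 : {ffun 'I_j2 -> 'I_l} | incr r2)
         G l (fcomp r1 p1) (fcomp r2 p2)))).
  rewrite exchange_merge_sum_big; apply: eq_merge_sum => j1 p1 p1o.
  under eq_bigr do rewrite exchange_merge_sum_big.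
  rewrite exchange_merge_sum_big; apply: eq_merge_sum => j2 p2 p2o.
  rewrite -(@big_ord_vanish _ (j1 + j2).+1 (m + s).+1 (fun l =>
    \sum_(r : {ffun 'I_(j1 + j2) -> 'I_l} | is_qsh r) F l (fcomp r (dsum p1 p2)))).
  - apply: eq_bigr => l _; rewrite big_mkcond big_glue [RHS]big_mkcond.
    apply: eq_bigr => r1 _.
    have eg (r2 : {ffun 'I_j2 -> 'I_l}) :
        fcomp [ffun i => glue r1 r2 i] (dsum p1 p2) =
        [ffun i => glue (fcomp r1 p1) (fcomp r2 p2) i].
      apply/ffunP => i; rewrite !ffunE; case: (split_ordP i) => u ->.
        by rewrite dsum_lshift !glue_lshift ffunE.
      by rewrite dsum_rshift !glue_rshift ffunE.
    have eo (r2 : {ffun 'I_j2 -> 'I_l}) :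
        onto [ffun i => glue (fcomp r1 p1) (fcomp r2 p2) i] =
        onto [ffun i => glue r1 r2 i].
      rewrite -eg; apply/ontoP/ontoP => h x; have [u <-] := h x.
        by rewrite ffunE; eexists.
      have /ontoP/(_ u)[v <-] : onto (dsum p1 p2) by rewrite onto_dsum p1o.
      by exists v; rewrite !ffunE.
    have qE (r2 : {ffun 'I_j2 -> 'I_l}) :
        is_qsh [ffun i => glue r1 r2 i] =
        [&& incr r1, incr r2 & onto [ffun i => glue r1 r2 i]].
      have el : (fun u => [ffun i => glue r1 r2 i] (lshift j2 u)) =1 r1.
        by move=> u; rewrite ffunE glue_lshift.
      have er : (fun u => [ffun i => glue r1 r2 i] (rshift j1 u)) =1 r2.
        by move=> u; rewrite ffunE glue_rshift.
      by rewrite is_qshE (eq_incr el) (eq_incr er).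
    case: ifP => h1; last by apply: big1 => r2 _; rewrite qE h1.
    rewrite [RHS]big_mkcond; apply: eq_bigr => r2 _.
    by rewrite qE h1 /G /= eg eo; case: (incr r2).
  - by rewrite ltnS leq_add // ?(onto_leq p1o) ?(onto_leq p2o).
  move=> l lt_l; apply: big1 => r; rewrite is_qshE => /and3P[_ _ /onto_leq].
  by rewrite leqNgt lt_l.
apply: eq_bigr => l _.
rewrite (merge_sum_epi_mono (fun g1 => merge_sum (fun j2 (p2 : {ffun 'I_s -> 'I_j2}) =>
  \sum_(r2 : {ffun 'I_j2 -> 'I_l} | incr r2) G l g1 (fcomp r2 p2)))).
rewrite [RHS]big_mkcond big_glue; apply: eq_bigr => g1 _.
rewrite merge_sum_epi_mono scaler_sumr; apply: eq_bigr => g2 _.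
rewrite /G /=; case: ifP => _; last by rewrite !scaler0.
rewrite scalerA; congr (_ * _ *: _); apply: eq_weight => u; rewrite ffunE.
  by rewrite glue_lshift.
by rewrite glue_rshift.
Qed.

(** The exponential carries shuffles to quasi-shuffles, in one direction. The
    function [F] is arbitrary, so that the identity can be used for the rows
    with [F] a sum over maps of the columns, and then for the columns. *)
Lemma merge_shuffle (V : lmodType K) (m s : nat)
    (F : forall l, {ffun 'I_(m + s) -> 'I_l} -> V) :
  \sum_(t in sh m s) merge_sum (fun l p => F l (fcomp p t)) =
  merge_sum (fun j1 (p1 : {ffun 'I_m -> 'I_j1}) =>
    merge_sum (fun j2 (p2 : {ffun 'I_s -> 'I_j2}) =>
      \sum_(l < (j1 + j2).+1)
        \sum_(r : {ffun 'I_(j1 + j2) -> 'I_l} | is_qsh r)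
          F l (fcomp r (dsum p1 p2)))).
Proof. by rewrite shuffle_merge_halves merge_qshuffle_halves. Qed.

End Weights.

(** * Linear extension to free modules *)

Section FreeModuleTheory.
Variable K : comNzRingType.

Lemma lin_extEw (I : choiceType) (V : lmodType K) (f : I -> V)
    (x : {malg K[I]}) (D : {fset I}) :
  (msupp x `<=` D)%fset -> lin_ext f x = \sum_(a <- D) x@_a *: f a.
Proof.
move=> sD; apply: big_fset_incl => // a _ /mcoeff_outdom ->.
by rewrite scale0r.
Qed.

Fact lin_ext_is_linear (I : choiceType) (V : lmodType K) (f : I -> V) :
  linear (lin_ext f).
Proof.
move=> c x y; pose D := (msupp x `|` msupp y `|` msupp (c *: x + y))%fset.
rewrite !(@lin_extEw _ _ _ _ D); last 3 first.
- by apply/fsubsetP => a; rewrite !inE => ->; rewrite orbT.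
- by apply/fsubsetP => a; rewrite !inE => ->.
- by apply/fsubsetP => a; rewrite !inE => ->; rewrite orbT.
rewrite scaler_sumr -big_split /=; apply: eq_bigr => a _.
by rewrite mcoeffD mcoeffZ scalerDl scalerA.
Qed.

HB.instance Definition _ (I : choiceType) (V : lmodType K) (f : I -> V) :=
  GRing.isLinear.Build K {malg K[I]} V *:%R (lin_ext f) (lin_ext_is_linear f).

Lemma lin_extU (I : choiceType) (V : lmodType K) (f : I -> V) (a : I) :
  lin_ext f << a >> = f a.
Proof.
rewrite (@lin_extEw _ _ _ _ [fset a]%fset) ?msuppU_le //.
by rewrite big_seq_fset1 mcoeffUU scale1r.
Qed.

Lemma lin_ext_sumU (I : choiceType) (V : lmodType K) (f : I -> V) (s : seq I) :
  lin_ext f (\sum_(a <- s) << a >>) = \sum_(a <- s) f a.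
Proof. by rewrite linear_sum; apply: eq_bigr => a _; apply: lin_extU. Qed.

Lemma malg_lin_ext (I : choiceType) (x : {malg K[I]}) :
  x = lin_ext (fun a => << a >>) x.
Proof.
rewrite {1}[x]monalgE; apply: eq_bigr => a _; apply/malgP => b.
by rewrite mcoeffZ !mcoeffU mulr_natr.
Qed.

Lemma linear_lin_ext (I : choiceType) (V W : lmodType K) (g : {linear V -> W})
    (f : I -> V) (x : {malg K[I]}) :
  g (lin_ext f x) = lin_ext (fun a => g (f a)) x.
Proof. by rewrite linear_sum; apply: eq_bigr => a _; rewrite linearZ. Qed.

Lemma eq_lin_ext (I : choiceType) (V : lmodType K) (f g : I -> V) :
  f =1 g -> lin_ext f =1 lin_ext g.
Proof. by move=> e x; apply: eq_bigr => a _; rewrite e. Qed.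

Lemma linear_basis (I : choiceType) (V : lmodType K)
    (g : {linear {malg K[I]} -> V}) (x : {malg K[I]}) :
  g x = lin_ext (fun a => g << a >>) x.
Proof. by rewrite {1}[x]malg_lin_ext linear_lin_ext. Qed.

Lemma eq_linear_basis (I : choiceType) (V : lmodType K)
    (f g : {linear {malg K[I]} -> V}) :
  (forall a, f << a >> = g << a >>) -> f =1 g.
Proof.
by move=> e x; rewrite (linear_basis f) (linear_basis g); apply: eq_lin_ext.
Qed.

Lemma mcoeff_lin_ext (I J : choiceType) (f : I -> {malg K[J]})
    (x : {malg K[I]}) (c : J) :
  (lin_ext f x)@_c = \sum_(a <- msupp x) x@_a * (f a)@_c.
Proof. by rewrite raddf_sum; apply: eq_bigr => a _ /=; rewrite mcoeffZ. Qed.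

Lemma bilin_extC (I J : choiceType) (V : lmodType K) (f : I -> J -> V) x y :
  bilin_ext f x y = bilin_ext (fun b a => f a b) y x.
Proof.
rewrite /bilin_ext /lin_ext.
under eq_bigr do rewrite scaler_sumr.
rewrite exchange_big; apply: eq_bigr => b _; rewrite scaler_sumr.
by apply: eq_bigr => a _; rewrite !scalerA mulrC.
Qed.

Lemma bilin_extUl (I J : choiceType) (V : lmodType K) (f : I -> J -> V) a y :
  bilin_ext f << a >> y = lin_ext (f a) y.
Proof. by rewrite /bilin_ext lin_extU. Qed.

Lemma bilin_extUU (I J : choiceType) (V : lmodType K) (f : I -> J -> V) a b :
  bilin_ext f << a >> << b >> = f a b.
Proof. by rewrite bilin_extUl lin_extU. Qed.

Fact bilin_ext_is_linear (I J : choiceType) (V : lmodType K) (f : I -> J -> V) x :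
  linear (bilin_ext f x).
Proof. by move=> c y z; rewrite !(bilin_extC _ x) [LHS]linearP. Qed.

HB.instance Definition _ (I J : choiceType) (V : lmodType K) (f : I -> J -> V) x :=
  GRing.isLinear.Build K {malg K[J]} V *:%R (bilin_ext f x) (bilin_ext_is_linear f x).

(** [bilin_ext] with its second argument fixed, named so that its linearity can
    be declared. *)
Definition bilin_extr (I J : choiceType) (V : lmodType K) (f : I -> J -> V) y :=
  fun x => bilin_ext f x y.

Fact bilin_extr_is_linear (I J : choiceType) (V : lmodType K) (f : I -> J -> V) y :
  linear (bilin_extr f y).
Proof. by move=> c x z; rewrite /bilin_extr /bilin_ext linearP. Qed.

HB.instance Definition _ (I J : choiceType) (V : lmodType K) (f : I -> J -> V) y :=
  GRing.isLinear.Build K {malg K[I]} V *:%R (bilin_extr f y) (bilin_extr_is_linear f y).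

Lemma mcoeff_tensor (I J : choiceType) (u : {malg K[I]}) (v : {malg K[J]}) a b :
  (tensor u v)@_(a, b) = u@_a * v@_b.
Proof.
rewrite /tensor /bilin_ext mcoeff_lin_ext.
rewrite [X in X@_a]malg_lin_ext mcoeff_lin_ext mulr_suml.
apply: eq_bigr => a' _; rewrite -mulrA; congr (_ * _).
rewrite mcoeff_lin_ext [X in X@_b]malg_lin_ext mcoeff_lin_ext mulr_sumr.
apply: eq_bigr => b' _. rewrite !mcoeffU -pair_eqE /= /pair_eq /=.
by case: (a' == a); case: (b' == b); rewrite ?mul0r ?mulr0 ?mul1r ?mulr1.
Qed.

Fact tensor_map_is_linear (I J I' J' : choiceType)
  (f : {malg K[I]} -> {malg K[I']}) (g : {malg K[J]} -> {malg K[J']}) :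
  linear (tensor_map f g).
Proof. exact: lin_ext_is_linear. Qed.

HB.instance Definition _ (I J I' J' : choiceType)
    (f : {malg K[I]} -> {malg K[I']}) (g : {malg K[J]} -> {malg K[J']}) :=
  GRing.isLinear.Build K {malg K[(I * J)%type]} {malg K[(I' * J')%type]} *:%R
    (tensor_map f g) (tensor_map_is_linear f g).

Lemma lin_ext_tensor (I J : choiceType) (V : lmodType K) (h : I * J -> V)
    (u : {malg K[I]}) (v : {malg K[J]}) :
  lin_ext h (tensor u v) = bilin_ext (fun a b => h (a, b)) u v.
Proof.
rewrite linear_lin_ext; apply: eq_lin_ext => a.
by rewrite linear_lin_ext; apply: eq_lin_ext => b; exact: lin_extU.
Qed.

(** For an element of the kernel, the coefficients vanish by descending
    induction on the size; each basis element is in the image by ascending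
    induction on the size. *)
Lemma unitriangular_bij (I : choiceType) (sz : I -> nat)
    (f : {linear {malg K[I]} -> {malg K[I]}}) :
  (forall a c, (sz a <= sz c)%N -> (f << a >>)@_c = (a == c)%:R) ->
  bijective f.
Proof.
move=> tri.
have supp_small a c : (f << a >> - << a >>)@_c != 0 -> (sz c < sz a)%N.
  rewrite ltnNge; apply: contra => le_ac.
  by rewrite mcoeffB mcoeffU tri // subrr.
have fI : injective f.
  apply: raddf_inj => x; rewrite -[LHS]/(f x) => fx0.
  apply/malgP => c; rewrite mcoeff0.
  pose N := \max_(a <- msupp x) sz a.
  have leN a : x@_a != 0 -> (sz a <= N)%N.
    by rewrite mcoeff_neq0 => ax; apply: leq_bigmax_seq.
  suff vanish n : forall b, (N < sz b + n)%N -> x@_b = 0.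
    by apply: (vanish N.+1); rewrite addnS ltnS leq_addl.
  elim: n => [|n IH] b lt_N.
    apply/eqP; apply: contraTT lt_N => /leN.
    by rewrite addn0 -leqNgt.
  have := congr1 (fun y => y@_b) fx0.
  rewrite (linear_basis f) mcoeff_lin_ext mcoeff0 => <-.
  rewrite {1}[x]malg_lin_ext mcoeff_lin_ext; apply: eq_bigr => a _.
  rewrite mcoeffU; have [/tri -> //|lt_ba] := leqP (sz a) (sz b).
  by rewrite IH ?mul0r // (leq_trans lt_N) // addnS -addSn leq_add2r.
have span z : (forall c, c \in msupp z -> exists x, f x = << c >>) ->
    exists x, f x = z.
  move=> h; rewrite [z]malg_lin_ext /lin_ext.
  have {h} : forall c, c \in (msupp z : seq I) -> exists x, f x = << c >> by [].
  elim: (msupp z : seq I) => [_|a s IH h].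
    by exists 0; rewrite linear0 big_nil.
  have [|x ex] := IH; first by move=> c cs; apply: h; rewrite inE cs orbT.
  have [|y ey] := h a; first exact: mem_head.
  by exists (z@_a *: y + x); rewrite linearP big_cons ex ey.
have fS y : exists x, f x == y.
  have basis n a : (sz a < n)%N -> exists x, f x = << a >>.
    elim: n a => // n IH a; rewrite ltnS => le_an.
    have [c|x ex] := span (f << a >> - << a >>).
      rewrite -mcoeff_neq0 => /supp_small lt_ca.
      by apply: IH; apply: leq_trans lt_ca le_an.
    by exists (<< a >> - x); rewrite linearB ex opprB addrC subrK.
  have [c _|x <-] := span y; last by exists x.
  exact: (basis (sz c).+1).
exists (fun y => xchoose (fS y)) => [x|y].
  by apply/fI/eqP/(xchooseP (fS (f x))).
by apply/eqP/(xchooseP (fS y)).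
Qed.

End FreeModuleTheory.

(** * Contractions of matrices *)

Section Contractions.
Variable d : nat.
Local Notation M := {cmonom 'I_d}.
Local Notation eps := (@mone M).

Lemma eq_contractM (m n j k : nat) (A : 'M[M]_(m, n)) (p p' : 'I_m -> 'I_j)
    (q q' : 'I_n -> 'I_k) :
  p =1 p' -> q =1 q' -> contractM A p q = contractM A p' q'.
Proof.
move=> ep eq; apply/matrixP => x y; rewrite !mxE.
apply: eq_big => [u|u _]; first by rewrite ep.
by apply: eq_bigl => v; rewrite eq.
Qed.

Lemma contractM_comp (m n j k j' k' : nat) (A : 'M[M]_(m, n))
    (p : 'I_m -> 'I_j) (q : 'I_n -> 'I_k) (p' : 'I_j -> 'I_j') (q' : 'I_k -> 'I_k') :
  contractM (contractM A p q) p' q' = contractM A (fcomp p' p) (fcomp q' q).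
Proof.
apply/matrixP => x y; rewrite !mxE.
rewrite [RHS](partition_big p (fun x' => p' x' == x)) => [|u]; last first.
  by rewrite ffunE.
apply: eq_bigr => x' /eqP ex.
transitivity (\big[mmul/eps]_(y' | q' y' == y) \big[mmul/eps]_(u | p u == x')
    \big[mmul/eps]_(v | q v == y') A u v).
  by apply: eq_bigr => y' _; rewrite mxE.
rewrite exchange_big; apply: eq_big => [u|u _].
  by rewrite ffunE; case: eqP => [->|]; rewrite ?andbF // ex eqxx.
rewrite [RHS](partition_big q (fun y' => q' y' == y)) => [|v]; last first.
  by rewrite ffunE.
apply: eq_bigr => y' /eqP ey; apply: eq_bigl => v.
by rewrite ffunE; case: eqP => [->|]; rewrite ?andbF // ey eqxx.
Qed.

Lemma big_dsum_lshift (m s j k : nat) (p1 : 'I_m -> 'I_j) (p2 : 'I_s -> 'I_k)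
    (x : 'I_j) (F : 'I_(m + s) -> M) :
  \big[mmul/eps]_(u | dsum p1 p2 u == lshift k x) F u =
  \big[mmul/eps]_(u | p1 u == x) F (lshift s u).
Proof.
rewrite big_split_ord /= [X in mmul _ X]big1 => [|u]; last first.
  by rewrite dsum_rshift eq_rlshift.
by rewrite mulm1; apply: eq_bigl => u; rewrite dsum_lshift eq_lshift.
Qed.

Lemma big_dsum_rshift (m s j k : nat) (p1 : 'I_m -> 'I_j) (p2 : 'I_s -> 'I_k)
    (x : 'I_k) (F : 'I_(m + s) -> M) :
  \big[mmul/eps]_(u | dsum p1 p2 u == rshift j x) F u =
  \big[mmul/eps]_(u | p2 u == x) F (rshift m u).
Proof.
rewrite big_split_ord /= [X in mmul X _]big1 => [|u]; last first.
  by rewrite dsum_lshift eq_lrshift.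
by rewrite mul1m; apply: eq_bigl => u; rewrite dsum_rshift eq_rshift.
Qed.

Lemma contractM_diag (m n s t j1 k1 j2 k2 : nat)
    (A : 'M[M]_(m, n)) (B : 'M[M]_(s, t))
    (p1 : 'I_m -> 'I_j1) (q1 : 'I_n -> 'I_k1)
    (p2 : 'I_s -> 'I_j2) (q2 : 'I_t -> 'I_k2) :
  contractM (diagM A B) (dsum p1 p2) (dsum q1 q2) =
  diagM (contractM A p1 q1) (contractM B p2 q2).
Proof.
apply/matrixP => x y; rewrite mxE.
case: (split_ordP x) => x' ->; case: (split_ordP y) => y' ->; rewrite /diagM.
- rewrite block_mxEul mxE big_dsum_lshift; apply: eq_bigr => u _.
  by rewrite big_dsum_lshift; apply: eq_bigr => v _; rewrite block_mxEul.
- rewrite block_mxEur mxE big_dsum_lshift; apply: big1 => u _.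
  by rewrite big_dsum_rshift; apply: big1 => v _; rewrite block_mxEur mxE.
- rewrite block_mxEdl mxE big_dsum_rshift; apply: big1 => u _.
  by rewrite big_dsum_lshift; apply: big1 => v _; rewrite block_mxEdl mxE.
- rewrite block_mxEdr mxE big_dsum_rshift; apply: eq_bigr => u _.
  by rewrite big_dsum_rshift; apply: eq_bigr => v _; rewrite block_mxEdr.
Qed.

Lemma permuteM_contract (m n : nat) (A : 'M[M]_(m, n)) (p : 'S_m) (q : 'S_n) :
  permuteM A p q = contractM A p q.
Proof.
apply/matrixP => x y; rewrite !mxE (big_pred1 (p^-1%g x)) => [|u]; last first.
  by rewrite /= -[RHS](inj_eq (@perm_inj _ p)) permKV.
rewrite (big_pred1 (q^-1%g y)) // => u.
by rewrite /= -[RHS](inj_eq (@perm_inj _ q)) permKV.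
Qed.

Lemma contractM_id (m n : nat) (A : 'M[M]_(m, n)) : contractM A id id = A.
Proof. by apply/matrixP => x y; rewrite mxE !big_pred1_eq. Qed.

Lemma contractM_proper (m n j k : nat) (A : 'M[M]_(m, n))
    (p : 'I_m -> 'I_j) (q : 'I_n -> 'I_k) :
  no_trivial_line A -> onto p -> onto q -> no_trivial_line (contractM A p q).
Proof.
move=> /no_trivial_lineP[ra ca] /ontoP po /ontoP qo.
apply/no_trivial_lineP; split=> [x|y].
  have [u <-] := po x; have [v hv] := ra u.
  by exists (q v); apply: contractM_neq.
have [v <-] := qo y; have [u hu] := ca v.
by exists (p u); apply: contractM_neq.
Qed.

End Contractions.

(** * The exponential map is multiplicative *)

Section ExponentialMap.
Variables (K : comNzRingType) (rho : {rmorphism rat -> K}) (d : nat).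
Local Notation M := {cmonom 'I_d}.
Local Notation eps := (@mone M).
Local Notation H := {malg K[comp d]}.
Local Notation merge_sum := (merge_sum rho).

(** Matrices with a trivial line are sent to 0, so that contractions can be
    summed without carrying proofs. *)
Definition mx_basis (m n : nat) (A : 'M[M]_(m, n)) : H :=
  if insub (existT (fun mn : nat * nat => 'M[M]_(mn.1, mn.2)) (m, n) A)
    is Some c then << (c : comp d) >> else 0.

Lemma mx_basisE (m n : nat) (A : 'M[M]_(m, n)) (h : no_trivial_line A) :
  mx_basis A = << mkcomp h >>.
Proof. by rewrite /mx_basis insubT. Qed.

(** The identities contribute [a] itself; the other terms of nonzero weight have
    fewer rows or fewer columns than [a]. *)
Definition exp_basis (a : comp d) : H :=
  merge_sum (fun j (p : {ffun 'I_(nrows a) -> 'I_j}) =>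
  merge_sum (fun k (q : {ffun 'I_(ncols a) -> 'I_k}) =>
    mx_basis (contractM (cmat a) p q))).

Definition exp_map : H -> H := lin_ext exp_basis.

HB.instance Definition _ := GRing.Linear.on exp_map.

Lemma exp_mapU (a : comp d) : exp_map << a >> = exp_basis a.
Proof. exact: lin_extU. Qed.

Lemma exp_map_mx (m n : nat) (A : 'M[M]_(m, n)) : no_trivial_line A ->
  exp_map (mx_basis A) =
  merge_sum (fun j (p : {ffun 'I_m -> 'I_j}) =>
  merge_sum (fun k (q : {ffun 'I_n -> 'I_k}) => mx_basis (contractM A p q))).
Proof. by move=> h; rewrite (mx_basisE h) exp_mapU. Qed.

Lemma onto_perm (m : nat) (p : 'S_m) : onto p.
Proof. by apply/ontoP => x; exists (p^-1%g x); rewrite permKV. Qed.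

Lemma shuffle_basisE (m n s t : nat) (A : 'M[M]_(m, n)) (B : 'M[M]_(s, t))
    (hA : no_trivial_line A) (hB : no_trivial_line B) :
  (0 < m)%N -> (0 < s)%N ->
  shuffle_basis K (mkcomp hA) (mkcomp hB) =
  \sum_(p in sh m s) \sum_(q in sh n t) mx_basis (contractM (diagM A B) p q).
Proof.
move=> m0 s0; rewrite /shuffle_basis !ifN; last 2 first.
- by apply: contraTneq s0 => /(congr1 (@nrows d)) e; rewrite (e : s = 0%N).
- by apply: contraTneq m0 => /(congr1 (@nrows d)) e; rewrite (e : m = 0%N).
apply: eq_bigr => p _; apply: eq_bigr => q _.
rewrite -permuteM_contract; apply/esym; exact: mx_basisE.
Qed.

Lemma big_qsh (m s j : nat) (F : {ffun 'I_(m + s) -> 'I_j} -> H) :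
  \sum_(p : qsh m s j) F (val p) = \sum_(f | is_qsh f) F f.
Proof.
rewrite [RHS](reindex_omap (val : qsh m s j -> _) insub) => [|i hi].
  by apply: eq_bigl => -[i hi] /=; rewrite insubT hi /= eqxx.
by rewrite insubT.
Qed.

Lemma big_ge1 (N : nat) (F : nat -> H) : F 0%N = 0 ->
  \sum_(1 <= j < N.+1) F j = \sum_(j < N.+1) F j.
Proof. by move=> F0; rewrite -(big_mkord xpredT) big_ltn // F0 add0r. Qed.

Lemma qshuffle_basisE (m n s t : nat) (A : 'M[M]_(m, n)) (B : 'M[M]_(s, t))
    (hA : no_trivial_line A) (hB : no_trivial_line B) :
  (0 < m)%N -> (0 < s)%N ->
  qshuffle_basis K (mkcomp hA) (mkcomp hB) =
  \sum_(j < (m + s).+1) \sum_(p : {ffun 'I_(m + s) -> 'I_j} | is_qsh p)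
  \sum_(k < (n + t).+1) \sum_(q : {ffun 'I_(n + t) -> 'I_k} | is_qsh q)
    mx_basis (contractM (diagM A B) p q).
Proof.
move=> m0 s0; rewrite /qshuffle_basis !ifN; last 2 first.
- by apply: contraTneq s0 => /(congr1 (@nrows d)) e; rewrite (e : s = 0%N).
- by apply: contraTneq m0 => /(congr1 (@nrows d)) e; rewrite (e : m = 0%N).
(* Nonempty words over no letters do not exist, so the indices j = 0 and
   k = 0 can be added to the sums. *)
have no0 x : (0 < x)%N -> ('I_x -> 'I_0) -> False by case: x => // x _ /(_ ord0) [].
have n0 : (0 < n)%N.
  case/no_trivial_lineP: (hA) => /(_ (Ordinal m0)) [v _] _.
  exact: leq_ltn_trans (ltn_ord v).
rewrite big_ge1; last first.
  apply: big1 => k _; apply: big1 => p _; case: (@no0 (m + s)%N).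
    by rewrite ltn_addr.
  exact: (val p).
apply: eq_bigr => j _; rewrite big_ge1; last first.
  apply: big1 => p _; apply: big1 => q _; case: (@no0 (n + t)%N).
    by rewrite ltn_addr.
  exact: (val q).
rewrite exchange_big -big_qsh; apply: eq_bigr => p _; apply: eq_bigr => k _.
rewrite -big_qsh; apply: eq_bigr => q _; apply/esym; exact: mx_basisE.
Qed.

(** Rows and columns are merged independently, and merging commutes with
    diagonal sums ([contractM_diag]), so [merge_shuffle] applies to the rows
    and then to the columns. *)
Lemma exp_map_shuffle_basis (a b : comp d) : a <> cempty -> b <> cempty ->
  exp_map (shuffle_basis K a b) =
  bilin_ext (@qshuffle_basis K d) (exp_map << a >>) (exp_map << b >>).
Proof.
move=> a0 b0; apply: etrans _
  (esym (f_equal2 (bilin_ext _) (exp_mapU a) (exp_mapU b))).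
move: a0 b0.
case: a => -[[m n] A] hA; case: b => -[[s t] B] hB a0 b0.
rewrite /= in A hA B hB a0 b0 *.
have m0 : (0 < m)%N by rewrite lt0n; apply/eqP => e; apply/a0/nrows_eq0.
have s0 : (0 < s)%N by rewrite lt0n; apply/eqP => e; apply/b0/nrows_eq0.
have hAB := cdiag_subproof (mkcomp hA) (mkcomp hB).
pose E l (g : {ffun 'I_(m + s) -> 'I_l}) k (h : {ffun 'I_(n + t) -> 'I_k}) : H :=
  mx_basis (contractM (diagM A B) g h).
apply: etrans (congr1 exp_map (shuffle_basisE hA hB m0 s0)) _.
transitivity (\sum_(p in sh m s) merge_sum (fun l (p' : {ffun 'I_(m + s) -> 'I_l}) =>
  \sum_(q in sh n t) merge_sum (fun k (q' : {ffun 'I_(n + t) -> 'I_k}) =>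
    E l (fcomp p' p) k (fcomp q' q)))).
  rewrite linear_sum; apply: eq_bigr => p _; rewrite linear_sum.
  rewrite -exchange_merge_sum_big; apply: eq_bigr => q _.
  apply: etrans (exp_map_mx _) _.
    by apply: contractM_proper; rewrite ?onto_perm.
  by do 2!(apply: eq_merge_sum => ? ? _); rewrite contractM_comp.
rewrite (merge_shuffle rho (fun l (g : {ffun 'I_(m + s) -> 'I_l}) =>
  \sum_(q in sh n t) merge_sum (fun k (q' : {ffun 'I_(n + t) -> 'I_k}) =>
    E l g k (fcomp q' q)))).
rewrite -[RHS]/(bilin_extr (@qshuffle_basis K d) _ (exp_basis _)).
rewrite /exp_basis.
rewrite merge_sum_linear.
apply: eq_merge_sum => j1 p1 p1o.
rewrite merge_sum_linear.
transitivity (merge_sum (fun k1 (q1 : {ffun 'I_n -> 'I_k1}) =>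
  merge_sum (fun j2 (p2 : {ffun 'I_s -> 'I_j2}) =>
  merge_sum (fun k2 (q2 : {ffun 'I_t -> 'I_k2}) =>
  \sum_(j < (j1 + j2).+1) \sum_(r : {ffun 'I_(j1 + j2) -> 'I_j} | is_qsh r)
  \sum_(k < (k1 + k2).+1) \sum_(r' : {ffun 'I_(k1 + k2) -> 'I_k} | is_qsh r')
    E j (fcomp r (dsum p1 p2)) k (fcomp r' (dsum q1 q2)))))).
  rewrite exchange_merge_sum; apply: eq_merge_sum => j2 p2 p2o.
  under eq_bigr => l _.
    under eq_bigr => r _.
      rewrite (merge_shuffle rho (fun k (h : {ffun 'I_(n + t) -> 'I_k}) =>
        E l (fcomp r (dsum p1 p2)) k h)).
      over.
    rewrite exchange_merge_sum_big.
    over.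
  rewrite exchange_merge_sum_big; apply: eq_merge_sum => k1 q1 q1o.
  under eq_bigr do rewrite exchange_merge_sum_big.
  by rewrite exchange_merge_sum_big.
apply: eq_merge_sum => k1 q1 q1o.
rewrite -[RHS]/(bilin_ext _ _ (merge_sum _)) merge_sum_linear.
apply: eq_merge_sum => j2 p2 p2o.
rewrite merge_sum_linear; apply: eq_merge_sum => k2 q2 q2o /=.
have hA' := contractM_proper hA p1o q1o.
have hB' := contractM_proper hB p2o q2o.
rewrite (mx_basisE hA') (mx_basisE hB') bilin_extUU qshuffle_basisE.

- do 4!(apply: eq_bigr => ? _).
  by rewrite /E -contractM_comp contractM_diag.
- exact: leq_ltn_trans (ltn_ord (p1 (Ordinal m0))).
- exact: leq_ltn_trans (ltn_ord (p2 (Ordinal s0))).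
Qed.

End ExponentialMap.

(** * Cuts of a composition *)

Lemma sum_eq_mem (R : pzRingType) (T : eqType) (s : seq T) (c : T) :
  uniq s -> \sum_(x <- s) (x == c)%:R = (c \in s)%:R :> R.
Proof.
move=> us; rewrite -count_uniq_mem // -sum1_count natr_sum [RHS]big_mkcond.
by apply: eq_bigr => x _ /=; case: eqP.
Qed.

Section Splits.
Variable d : nat.
Local Notation M := {cmonom 'I_d}.
Local Notation eps := (@mone M).

Definition splits (a : comp d) : seq (comp d * comp d) :=
  [seq (cdiags (take i (components a)), cdiags (drop i (components a)))
  | i <- iota 0 (size (components a)).+1].

Lemma componentsP (a : comp d) : components_spec a (components a).
Proof. exact: proj2_sig. Qed.

(** By uniqueness of components, the components of [cdiag b c] are those of [b]
    followed by those of [c]. *)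
Lemma mem_splits (a : comp d) (x : comp d * comp d) :
  (x \in splits a) = (cdiag x.1 x.2 == a).
Proof.
have [_ ea] := componentsP a.
apply/mapP/eqP => [[i _ ->] /=|]; first by rewrite -cdiags_cat cat_take_drop.
case: x => b c e; rewrite [_.1]/= [_.2]/= in e *.
have [cb eb] := componentsP b; have [cc ec] := componentsP c.
have eus : components a = components b ++ components c.
  rewrite -{1}e -{1}eb -{1}ec -cdiags_cat components_cdiags // => u.
  by rewrite mem_cat => /orP[/cb|/cc].
exists (size (components b)).
  by rewrite mem_iota eus size_cat /= ltnS leq_addr.
by rewrite eus take_size_cat // drop_size_cat // eb ec.
Qed.

Lemma splits_uniq (a : comp d) : uniq (splits a).
Proof.
have [ca _] := componentsP a.
rewrite map_inj_in_uniq ?iota_uniq // => i j.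
rewrite !mem_iota !ltnS /= => le_i le_j [e _].
have := congr1 (fun b => size (components b)) e.
by rewrite !components_cdiags ?size_takel // => u /mem_take /ca.
Qed.

(** The blocks inherit the absence of trivial lines, because a nontrivial entry
    of a line lies in the same diagonal block as the line. *)
Lemma comp_split (a : comp d) (m1 n1 : nat) :
  (m1 <= nrows a)%N -> (n1 <= ncols a)%N ->
  (forall i j, centry a i j != eps -> (i < m1)%N = (j < n1)%N) ->
  exists2 x, x \in splits a & nrows x.1 = m1 /\ ncols x.1 = n1.
Proof.
move=> le_m le_n h.
pose A1 : 'M[M]_(m1, n1) := \matrix_(i, j) centry a i j.
pose A2 : 'M[M]_(nrows a - m1, ncols a - n1) :=
  \matrix_(i, j) centry a (m1 + i) (n1 + j).
have h1 : no_trivial_line A1.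
  apply/no_trivial_lineP; split=> [i|j].
    have [j _ ne] := comp_row (leq_trans (ltn_ord i) le_m).
    have lt_j : (j < n1)%N by rewrite -(h _ _ ne).
    by exists (Ordinal lt_j); rewrite mxE.
  have [i _ ne] := comp_col (leq_trans (ltn_ord j) le_n).
  have lt_i : (i < m1)%N by rewrite (h _ _ ne).
  by exists (Ordinal lt_i); rewrite mxE.
have h2 : no_trivial_line A2.
  apply/no_trivial_lineP; split=> [i|j].
    have lt_i : (m1 + i < nrows a)%N by rewrite -ltn_subRL.
    have [j lt_j ne] := comp_row lt_i.
    have le_j : (n1 <= j)%N.
      by rewrite leqNgt -(h _ _ ne) -leqNgt leq_addr.
    have lt_j' : (j - n1 < ncols a - n1)%N by rewrite ltn_sub2rE.
    by exists (Ordinal lt_j'); rewrite mxE /= subnKC.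
  have lt_j : (n1 + j < ncols a)%N by rewrite -ltn_subRL.
  have [i lt_i ne] := comp_col lt_j.
  have le_i : (m1 <= i)%N.
    by rewrite leqNgt (h _ _ ne) -leqNgt leq_addr.
  have lt_i' : (i - m1 < nrows a - m1)%N by rewrite ltn_sub2rE.
  by exists (Ordinal lt_i'); rewrite mxE /= subnKC.
exists (mkcomp h1, mkcomp h2) => //; rewrite mem_splits; apply/eqP.
apply: comp_eqP => [||i j].
- by rewrite nrows_cdiag /= [RHS](esym (subnKC le_m)).
- by rewrite ncols_cdiag /= [RHS](esym (subnKC le_n)).
rewrite nrows_cdiag ncols_cdiag /= => lt_i lt_j.
rewrite centry_cdiag [nrows _]/= [ncols _]/=.
have [lt_im|le_im] := ltnP i m1.
  have [lt_jn|le_jn] := ltnP j n1.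
    by rewrite (@centryE d (mkcomp h1) (Ordinal lt_im) (Ordinal lt_jn)) mxE.
  rewrite centry_out ?[ncols _]/= ?(ltnNge j) ?le_jn ?andbF //.
  by apply/esym/eqP; apply: contraLR le_jn => /h; rewrite lt_im -ltnNge => <-.
have [lt_jn|le_jn] := ltnP j n1.
  by apply/esym/eqP; apply: contraLR le_im => /h; rewrite lt_jn -ltnNge => ->.
have lt_i' : (i - m1 < nrows a - m1)%N by rewrite ltn_subLR.
have lt_j' : (j - n1 < ncols a - n1)%N by rewrite ltn_subLR.
by rewrite (@centryE d (mkcomp h2) (Ordinal lt_i') (Ordinal lt_j')) mxE /= !subnKC.
Qed.

Lemma splits_eq (a : comp d) x y : x \in splits a -> y \in splits a ->
  nrows x.1 = nrows y.1 -> x = y.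
Proof.
rewrite !mem_splits => /eqP ex /eqP ey er.
have [|w ew] := @cdiag_prefix d x.1 x.2 y.1 y.2 _ (eq_leq er).
  by rewrite ex ey.
have w0 : w = cempty.
  apply: nrows_eq0; move: er; rewrite ew nrows_cdiag => /eqP.
  by rewrite -{1}[nrows x.1]addn0 eqn_add2l => /eqP.
have e1 : x.1 = y.1 by rewrite ew w0 cdiagc0.
move: ex; rewrite -ey e1 => /cdiagI e2.
by rewrite [x]surjective_pairing [y]surjective_pairing e1 e2.
Qed.

Lemma comul_basisE (K : comNzRingType) (a : comp d) :
  comul_basis K a = \sum_(x <- splits a) << x >>.
Proof. by rewrite /comul_basis big_map /index_iota subn0. Qed.

(** Deconcatenation is dual to the diagonal sum. *)
Lemma mcoeff_comul (K : comNzRingType) (x : {malg K[comp d]}) c1 c2 :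
  (comul x)@_(c1, c2) = x@_(cdiag c1 c2).
Proof.
rewrite [x in RHS]malg_lin_ext !mcoeff_lin_ext; apply: eq_bigr => a _.
rewrite comul_basisE raddf_sum [in RHS]mcoeffU eq_sym -(mem_splits a (c1, c2)).
rewrite -(sum_eq_mem K (c1, c2) (splits_uniq a)); congr (_ * _).
by apply: eq_bigr => y _; rewrite /= mcoeffU.
Qed.

End Splits.

(** * The exponential map is comultiplicative *)

(** Compatibility of a map with a cut of its source at [m1] and a cut of its
    target at [j1]; the compatible maps are the direct sums. *)
Definition aligned (m j m1 j1 : nat) (p : 'I_m -> 'I_j) : bool :=
  [forall u : 'I_m, (u < m1)%N == (p u < j1)%N].

Lemma alignedP (m j m1 j1 : nat) (p : 'I_m -> 'I_j) :
  reflect (forall u : 'I_m, (u < m1)%N = (p u < j1)%N) (aligned m1 j1 p).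
Proof.
apply: (iffP forallP) => h u; last by rewrite h.
exact: (eqP (h u)).
Qed.

(** The preimage of an initial segment under a nondecreasing map is an initial
    segment. *)
Lemma nondecr_aligned (m j j1 : nat) (p : 'I_m -> 'I_j) :
  nondecr p -> exists2 m1, (m1 <= m)%N & aligned m1 j1 p.
Proof.
move=> /nondecrP hp.
pose P i := [forall u : 'I_m, (i <= u)%N ==> (j1 <= p u)%N].
have exP : exists i, P i.
  by exists m; apply/forallP => u; rewrite leqNgt ltn_ord.
case: (ex_minnP exP) => m1 /forallP hm1 min.
exists m1; first by apply: min; apply/forallP => u; rewrite leqNgt ltn_ord.
apply/alignedP => u; rewrite !ltnNge; congr (~~ _); apply/idP/idP.
  by move/implyP: (hm1 u).
move=> le_pu; apply: min; apply/forallP => v; apply/implyP => /hp.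
exact: leq_trans.
Qed.

Lemma aligned_dsum (m1 m2 j1 j2 : nat) (p : {ffun 'I_(m1 + m2) -> 'I_(j1 + j2)}) :
  aligned m1 j1 p ->
  exists p1 : {ffun 'I_m1 -> 'I_j1}, exists p2 : {ffun 'I_m2 -> 'I_j2},
    p = [ffun i => dsum p1 p2 i].
Proof.
move=> /alignedP h.
have hl u : (p (lshift m2 u) < j1)%N by rewrite -h /=.
have hr v : (p (rshift m1 v) - j1 < j2)%N.
  have := h (rshift m1 v); rewrite /= ltnNge leq_addr /= => /esym/negbT.
  by rewrite -leqNgt => le_j; rewrite ltn_subLR.
exists [ffun u => Ordinal (hl u)], [ffun v => Ordinal (hr v)].
apply/ffunP => i; rewrite ffunE; case: (split_ordP i) => u ->; apply: val_inj.
  by rewrite dsum_lshift ffunE.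
rewrite dsum_rshift ffunE /= subnKC // leqNgt.
by rewrite -h /= -leqNgt leq_addr.
Qed.

Section Coefficients.
Variables (K : comNzRingType) (rho : {rmorphism rat -> K}) (d : nat).
Local Notation M := {cmonom 'I_d}.
Local Notation eps := (@mone M).
Local Notation H := {malg K[comp d]}.
Local Notation merge_sum := (merge_sum rho).

Lemma big_aligned (m1 m2 j1 j2 : nat)
    (F : {ffun 'I_(m1 + m2) -> 'I_(j1 + j2)} -> K) :
  \sum_(p : {ffun 'I_(m1 + m2) -> 'I_(j1 + j2)} | onto p && aligned m1 j1 p)
     weight rho p * F p =
  \sum_(p1 : {ffun 'I_m1 -> 'I_j1} | onto p1)
  \sum_(p2 : {ffun 'I_m2 -> 'I_j2} | onto p2)
     weight rho p1 * weight rho p2 * F [ffun i => dsum p1 p2 i].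
Proof.
pose h (x : {ffun 'I_m1 -> 'I_j1} * {ffun 'I_m2 -> 'I_j2}) :
  {ffun 'I_(m1 + m2) -> 'I_(j1 + j2)} := [ffun i => dsum x.1 x.2 i].
pose D := [set x : {ffun 'I_m1 -> 'I_j1} * {ffun 'I_m2 -> 'I_j2} |
  onto x.1 && onto x.2].
have hE x : h x =1 dsum x.1 x.2 by apply: ffunE.
rewrite (eq_bigl (mem (h @: D))) => [|p]; last first.
  apply/andP/imsetP => [[po pa]|[[p1 p2] + ->]]; last first.
    rewrite inE (eq_onto (hE _)) onto_dsum => ->; split=> //.
    apply/alignedP => i; rewrite hE.
    case: (split_ordP i) => u ->; rewrite ?(dsum_lshift, dsum_rshift) /=.
      by rewrite !ltn_ord.
    by rewrite !ltnNge !leq_addr.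
  have [p1 [p2 ep]] := aligned_dsum pa; exists (p1, p2) => //.
  by rewrite inE /= -onto_dsum -(eq_onto (hE (p1, p2))) /h /= -ep.
rewrite big_imset /=; last first.
  move=> [p1 p2] [p1' p2'] _ _ /ffunP e.
  congr (_, _); apply/ffunP => u.
    by have := e (lshift m2 u); rewrite !hE !dsum_lshift => /lshift_inj.
  by have := e (rshift m1 u); rewrite !hE !dsum_rshift => /rshift_inj.
rewrite pair_big_dep /=; apply: eq_big => [x|[p1 p2] _]; first by rewrite inE.
by rewrite (eq_weight rho (hE (p1, p2))) weight_dsum.
Qed.

Lemma mcoeff_merge_sum (m : nat) (F : forall j, {ffun 'I_m -> 'I_j} -> H) c :
  (merge_sum F)@_c =
  \sum_(j < m.+1) \sum_(p : {ffun 'I_m -> 'I_j} | onto p) weight rho p * (F j p)@_c.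
Proof.
rewrite raddf_sum; apply: eq_bigr => j _; rewrite raddf_sum.
by apply: eq_bigr => p _; rewrite /= mcoeffZ.
Qed.

Lemma big_onto_single (m j0 : nat) (F : forall j, {ffun 'I_m -> 'I_j} -> K) :
  (forall j p, j != j0 -> F j p = 0) ->
  \sum_(j < m.+1) \sum_(p : {ffun 'I_m -> 'I_j} | onto p) weight rho p * F j p =
  \sum_(p : {ffun 'I_m -> 'I_j0} | onto p) weight rho p * F j0 p.
Proof.
move=> F0; have [lt_j|le_j] := ltnP j0 m.+1.
  rewrite (bigD1 (Ordinal lt_j)) //= [X in _ + X]big1 ?addr0 // => j ne.
  by apply: big1 => p _; rewrite F0 ?mulr0.
rewrite [RHS]big1 => [|p /onto_leq]; last by rewrite leqNgt le_j.
apply: big1 => j _; apply: big1 => p _; rewrite F0 ?mulr0 //.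
by apply: contraTneq (ltn_ord j) => ->; rewrite -leqNgt.
Qed.

Lemma mcoeff_mx_basis (m n : nat) (A : 'M[M]_(m, n)) (c : comp d) :
  (mx_basis K A)@_c =
  (existT (fun mn : nat * nat => 'M[M]_(mn.1, mn.2)) (m, n) A == cval c)%:R.
Proof.
rewrite /mx_basis; case: insubP => [b _ eb|nA]; first by rewrite mcoeffU -eb.
rewrite mcoeff0; case: eqP => // e; case/negP: nA.
by rewrite e; apply: cvalP.
Qed.

Lemma mcoeff_exp_basis (a c : comp d) :
  (exp_basis rho a)@_c =
  \sum_(p : {ffun 'I_(nrows a) -> 'I_(nrows c)} | onto p) weight rho p *
  \sum_(q : {ffun 'I_(ncols a) -> 'I_(ncols c)} | onto q) weight rho q *
    (contractM (cmat a) p q == cmat c)%:R.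
Proof.
pose E j k (p : {ffun 'I_(nrows a) -> 'I_j}) (q : {ffun 'I_(ncols a) -> 'I_k}) :=
  (mx_basis K (contractM (cmat a) p q))@_c.
have E0 j k p q : (j != nrows c) || (k != ncols c) -> @E j k p q = 0.
  rewrite /E mcoeff_mx_basis => ne; case: (_ =P cval c) => // e; move: ne.
  by rewrite /nrows /ncols -e /= !eqxx.
have Ec p q : @E (nrows c) (ncols c) p q = (contractM (cmat a) p q == cmat c)%:R.
  rewrite /E mcoeff_mx_basis /cmat; congr (nat_of_bool _)%:R.
  move: p q; rewrite /nrows /ncols; case: (cval c) => -[m n] C p q /=.
  by rewrite eq_Tagged.
rewrite mcoeff_merge_sum.
rewrite (@big_onto_single _ (nrows c) (fun j p => (merge_sum
  (fun k (q : {ffun 'I_(ncols a) -> 'I_k}) =>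
    mx_basis K (contractM (cmat a) p q)))@_c)).
  apply: eq_bigr => p _; congr (_ * _); rewrite mcoeff_merge_sum.
  rewrite (@big_onto_single _ (ncols c) (fun k q => E _ k p q)) => [|k q ne].
    by apply: eq_bigr => q _; rewrite Ec.
  by rewrite E0 // ne orbT.
move=> j p ne; rewrite mcoeff_merge_sum.
by apply: big1 => k _; apply: big1 => q _; rewrite [X in _ * X]E0 ?ne ?mulr0.
Qed.

(** If the contraction of [a] along [p] and [q] is [cdiag c1 c2], then a
    nontrivial entry of [a] in row u and column v forces [p u] and [q v] to lie
    in the same block. So [a] has exactly one cut with which [p] and [q] are
    compatible, and summing over the cuts of [a] sorts the contractions by this
    cut. *)
Lemma exp_basis_splits (a c1 c2 : comp d) :
  (exp_basis rho a)@_(cdiag c1 c2) =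
  \sum_(x <- splits a) (exp_basis rho x.1)@_c1 * (exp_basis rho x.2)@_c2.
Proof.
rewrite mcoeff_exp_basis.
pose T (p : {ffun 'I_(nrows a) -> 'I_(nrows c1 + nrows c2)})
       (q : {ffun 'I_(ncols a) -> 'I_(ncols c1 + ncols c2)}) : K :=
  (contractM (cmat a) p q == diagM (cmat c1) (cmat c2))%:R.
(* For a fixed cut x, the pairs of merges of the two blocks are the merges
   of a that are compatible with x. *)
transitivity (\sum_(x <- splits a)
  \sum_(p : {ffun 'I_(nrows a) -> 'I_(nrows c1 + nrows c2)} |
        onto p && aligned (nrows x.1) (nrows c1) p) weight rho p *
  \sum_(q : {ffun 'I_(ncols a) -> 'I_(ncols c1 + ncols c2)} |
        onto q && aligned (ncols x.1) (ncols c1) q) weight rho q * T p q); last first.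
  apply: eq_big_seq => -[a1 a2]; rewrite mem_splits /= => /eqP ea.
  case: _ / ea @T => T.
  rewrite !mcoeff_exp_basis big_distrlr /= [LHS]big_aligned.
  apply: eq_bigr => p1 _; apply: eq_bigr => p2 _.
  rewrite mulrACA big_distrlr /=; congr (_ * _).
  rewrite [LHS]big_aligned; apply: eq_bigr => q1 _; apply: eq_bigr => q2 _.
  rewrite mulrACA; congr (_ * _); rewrite /T -natrM mulnb.
  rewrite (eq_contractM _ (ffunE _) (ffunE _)) contractM_diag; congr (_%:R).
  congr nat_of_bool; apply/eqP/andP => [/eq_block_mx[-> _ _ ->] //|].
  by case=> /eqP-> /eqP->.
pose S (x : comp d * comp d) (p : {ffun 'I_(nrows a) -> 'I_(nrows c1 + nrows c2)})
       (q : {ffun 'I_(ncols a) -> 'I_(ncols c1 + ncols c2)}) :=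
  aligned (nrows x.1) (nrows c1) p && aligned (ncols x.1) (ncols c1) q.
transitivity (\sum_(x <- splits a)
  \sum_(p : {ffun 'I_(nrows a) -> 'I_(nrows c1 + nrows c2)} | onto p)
  \sum_(q : {ffun 'I_(ncols a) -> 'I_(ncols c1 + ncols c2)} | onto q)
    (S x p q)%:R * (weight rho p * (weight rho q * T p q))); last first.
  apply: eq_bigr => x _; rewrite [RHS]big_mkcondr; apply: eq_bigr => p _.
  rewrite /S; case: (aligned _ _ p); last by apply: big1 => q _; rewrite mul0r.
  rewrite mulr_sumr [RHS]big_mkcondr; apply: eq_bigr => q _.
  by case: (aligned _ _ q); rewrite ?mul1r ?mul0r.
rewrite exchange_big; apply: eq_bigr => p po.
rewrite exchange_big /= mulr_sumr; apply: eq_bigr => q qo.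
rewrite -mulr_suml.
rewrite -[X in _ * (_ * X)]/(T p q).
have [wp|wp] := boolP (nondecr p); last by rewrite /weight (negPf wp) !mul0r mulr0.
have [wq|wq] := boolP (nondecr q).
  2: by rewrite [weight rho q]/weight (negPf wq) !(mul0r, mulr0).
have [eT|] := boolP (contractM (cmat a) p q == diagM (cmat c1) (cmat c2)).
  2: by rewrite /T => /negPf ->; rewrite !mulr0.
suff -> : \sum_(x <- splits a) (S x p q)%:R = 1 :> K by rewrite mul1r.
have [m1 le_m am] := nondecr_aligned (nrows c1) wp.
have [n1 le_n an] := nondecr_aligned (ncols c1) wq.
have [|x0 x0s [er ec]] := @comp_split d a m1 n1 le_m le_n.
  move=> i j ne; have /andP[lt_i lt_j] : (i < nrows a)%N && (j < ncols a)%N.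
    by apply: contraNT ne => out; apply/eqP/centry_out.
  have := ne; rewrite (@centryE d a (Ordinal lt_i) (Ordinal lt_j)).
  move=> /(@contractM_neq d _ _ _ _ _ p q); rewrite (eqP eT) /diagM.
  move/alignedP: am => /(_ (Ordinal lt_i)) /= ->.
  move/alignedP: an => /(_ (Ordinal lt_j)) /= ->.
  case: (split_ordP (p _)) => u ->; case: (split_ordP (q _)) => v ->.
  - by [].
  - by rewrite block_mxEur mxE eqxx.
  - by rewrite block_mxEdl mxE eqxx.
  - by [].
transitivity (\sum_(x <- splits a) (x == x0)%:R : K); last first.
  by rewrite sum_eq_mem ?splits_uniq // x0s.
apply: eq_big_seq => x xs; suff -> : S x p q = (x == x0) by [].
apply/idP/eqP => [/andP[/alignedP ax _]|->]; last by rewrite /S er ec am an.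
apply: (splits_eq xs x0s); rewrite er.
have le_x : (nrows x.1 <= nrows a)%N.
  by move: xs; rewrite mem_splits => /eqP <-; rewrite nrows_cdiag leq_addr.
move/alignedP: am => am.
have cmp k l : (k <= nrows a)%N -> (l <= nrows a)%N ->
    (forall u : 'I_(nrows a), (u < k)%N = (u < l)%N) -> (k <= l)%N.
  move=> le_k le_l e; rewrite leqNgt; apply/negP => lt_lk.
  by have := e (Ordinal (leq_trans lt_lk le_k)); rewrite /= lt_lk ltnn.
have e (u : 'I_(nrows a)) : (u < nrows x.1)%N = (u < m1)%N.
  exact: etrans (ax u) (esym (am u)).
apply/eqP; rewrite eqn_leq (cmp _ _ le_x le_m e).
exact: cmp le_m le_x (fun u => esym (e u)).
Qed.

Lemma mcoeff_exp_map (x : H) c :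
  (exp_map rho x)@_c = \sum_(a <- msupp x) x@_a * (exp_basis rho a)@_c.
Proof. exact: mcoeff_lin_ext. Qed.

Lemma exp_map_comul (x : H) :
  comul (exp_map rho x) =
  tensor_map (@exp_map K rho d) (@exp_map K rho d) (comul x).
Proof.
apply/malgP => -[c1 c2]; rewrite mcoeff_comul mcoeff_exp_map.
rewrite /comul [in RHS]linear_lin_ext mcoeff_lin_ext; apply: eq_bigr => a _.
congr (_ * _); rewrite exp_basis_splits comul_basisE linear_sum raddf_sum.
apply: eq_bigr => -[a1 a2] _ /=.
rewrite -(exp_mapU rho a1) -(exp_mapU rho a2).
by rewrite /tensor_map lin_extU mcoeff_tensor.
Qed.

End Coefficients.

(** * The isomorphism *)

Lemma bilin_ext_comp (K : comNzRingType) (I J : choiceType) (V : lmodType K)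
    (f : I -> J -> V) (S : {linear {malg K[I]} -> {malg K[I]}}) u v :
  bilin_ext f (S u) v = bilin_ext (fun a b => bilin_ext f (S << a >>) << b >>) u v.
Proof.
have e a : lin_ext (fun b => bilin_ext f (S << a >>) << b >>) v =
    bilin_ext f (S << a >>) v.
  exact/esym/(linear_basis (bilin_ext f (S << a >>)) v).
rewrite -[LHS]/([the {linear _ -> _} of bilin_extr f v \o S] u) linear_basis.
by apply: eq_lin_ext => a; rewrite e.
Qed.

Section Isomorphism.
Variables (K : comNzRingType) (rho : {rmorphism rat -> K}) (d : nat).
Local Notation H := {malg K[comp d]}.
Local Notation exp_map := (@exp_map K rho d).
Local Notation shmul := (bilin_ext (@shuffle_basis K d)).
Local Notation qmul := (bilin_ext (@qshuffle_basis K d)).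

Lemma nondecr_onto_id (m : nat) (p : {ffun 'I_m -> 'I_m}) :
  nondecr p -> onto p -> p = [ffun u => u].
Proof.
move=> pn po; have cd : codom p =i 'I_m.
  by move=> x; move/ontoP: po => /(_ x) [u <-]; rewrite codom_f.
have pI : injective p.
  have /image_injP h : #|image p 'I_m| == #|'I_m| by rewrite (eq_card cd).
  by move=> u v; apply: h.
apply/ffunP => u; rewrite ffunE.
apply: (@incr_image_eq _ _ p id (nondecr_inj_incr pn pI)) => [|x].
  exact/incrP.
by rewrite cd; symmetry; apply: (codom_f id).
Qed.

(** Among the merges that keep all indices apart, only the identity has a
    nonzero weight. *)
Lemma big_onto_endo (m : nat) (F : {ffun 'I_m -> 'I_m} -> K) :
  \sum_(p : {ffun 'I_m -> 'I_m} | onto p) weight rho p * F p = F [ffun u => u].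
Proof.
have idi : incr [ffun u : 'I_m => u] by apply/incrP => u v; rewrite !ffunE.
rewrite (bigD1 [ffun u => u]) /=; last by apply/ontoP => x; exists x; rewrite ffunE.
rewrite weight_incr // mul1r big1 ?addr0 // => p /andP[po ne].
rewrite /weight; case: ifP => pn; last by rewrite mul0r.
by rewrite (nondecr_onto_id pn po) eqxx in ne.
Qed.

Lemma exp_basis_tri (a c : comp d) :
  (nrows a + ncols a <= nrows c + ncols c)%N ->
  (exp_basis rho a)@_c = (a == c)%:R.
Proof.
rewrite mcoeff_exp_basis => le_ac.
have [lt_r|le_r] := ltnP (nrows a) (nrows c).
  rewrite big1 => [|p /onto_leq]; last by rewrite leqNgt lt_r.
  by case: eqP lt_r => // ->; rewrite ltnn.
have [lt_c|le_c] := ltnP (ncols a) (ncols c).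
  rewrite big1 => [|p _].
    by case: eqP lt_c => // ->; rewrite ltnn.
  by rewrite big1 ?mulr0 // => q /onto_leq; rewrite leqNgt lt_c.
have er : nrows a = nrows c.
  apply/eqP; rewrite eqn_leq le_r andbT -(leq_add2r (ncols c)).
  by rewrite (leq_trans _ le_ac) ?leq_add2l.
have ec : ncols a = ncols c.
  by apply/eqP; rewrite eqn_leq le_c andbT -(leq_add2l (nrows a)) {2}er.
move: er ec; clear; case: a => -[[m n] A] hA; case: c => -[[m' n'] C] hC.
rewrite /nrows /ncols /= => em en.
subst m'; subst n'.
rewrite [LHS]big_onto_endo [LHS]big_onto_endo.
rewrite (eq_contractM _ (ffunE _) (ffunE _)) contractM_id.
congr (nat_of_bool _)%:R; rewrite -[RHS]val_eqE; symmetry; exact: eq_Tagged.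
Qed.

Lemma exp_map_tri (a c : comp d) :
  (nrows a + ncols a <= nrows c + ncols c)%N -> (exp_map << a >>)@_c = (a == c)%:R.
Proof. by move=> h; rewrite (exp_mapU rho a) exp_basis_tri. Qed.

Lemma exp_map_bij : bijective exp_map.
Proof.
pose sz (a : comp d) := (nrows a + ncols a)%N.
exact: (unitriangular_bij (sz := sz) exp_map_tri).
Qed.

Lemma exp_map_one : exp_map << cempty >> = << cempty >>.
Proof. by apply/malgP => c; rewrite exp_map_tri // mcoeffU. Qed.

Lemma shmul1l (x : H) : shmul << cempty >> x = x.
Proof.
rewrite bilin_extUl [RHS]malg_lin_ext; apply: eq_lin_ext => a.
by rewrite /shuffle_basis (eqxx cempty).
Qed.

Lemma shmul1r (x : H) : shmul x << cempty >> = x.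
Proof.
rewrite bilin_extC bilin_extUl [RHS]malg_lin_ext; apply: eq_lin_ext => a.
by rewrite /shuffle_basis (eqxx cempty); case: (a =P cempty) => [->|_].
Qed.

Lemma qmul1l (x : H) : qmul << cempty >> x = x.
Proof.
rewrite bilin_extUl [RHS]malg_lin_ext; apply: eq_lin_ext => a.
by rewrite /qshuffle_basis (eqxx cempty).
Qed.

Lemma qmul1r (x : H) : qmul x << cempty >> = x.
Proof.
rewrite bilin_extC bilin_extUl [RHS]malg_lin_ext; apply: eq_lin_ext => a.
by rewrite /qshuffle_basis (eqxx cempty); case: (a =P cempty) => [->|_].
Qed.

Lemma exp_map_qmul1l (x : H) : qmul (exp_map << cempty >>) x = x.
Proof. by rewrite exp_map_one qmul1l. Qed.

Lemma exp_map_qmul1r (x : H) : qmul x (exp_map << cempty >>) = x.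
Proof. exact: etrans (congr1 (qmul x) exp_map_one) (qmul1r x). Qed.

Lemma exp_map_mul_basis (a b : comp d) :
  exp_map (shmul << a >> << b >>) = qmul (exp_map << a >>) (exp_map << b >>).
Proof.
case: (a =P cempty) => [->|a0].
  by rewrite shmul1l exp_map_qmul1l.
case: (b =P cempty) => [->|b0].
  by rewrite shmul1r exp_map_qmul1r.
by rewrite bilin_extUU exp_map_shuffle_basis.
Qed.

Lemma exp_map_mul (x y : H) : exp_map (shmul x y) = qmul (exp_map x) (exp_map y).
Proof.
pose F := [the {linear _ -> _} of exp_map \o bilin_extr (@shuffle_basis K d) y].
pose G := [the {linear _ -> _} of
  bilin_extr (@qshuffle_basis K d) (exp_map y) \o exp_map].
apply: (eq_linear_basis (f := F) (g := G) _ x) => a.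
pose F' := [the {linear _ -> _} of exp_map \o shmul << a >>].
pose G' := [the {linear _ -> _} of qmul (exp_map << a >>) \o exp_map].
exact: (eq_linear_basis (f := F') (g := G') (exp_map_mul_basis a) y).
Qed.

Lemma exp_map_counit (x : H) : counit (exp_map x) = counit x.
Proof.
rewrite /counit mcoeff_exp_map [x in RHS]malg_lin_ext mcoeff_lin_ext.
apply: eq_bigr => a _; congr (_ * _); rewrite mcoeffU.
case: (a =P cempty) => [->|a0]; first by rewrite exp_basis_tri // eqxx.
rewrite mcoeff_exp_basis big1 // => p _.
have a1 : (0 < nrows a)%N by rewrite lt0n; apply/eqP => /nrows_eq0.
by case: (p (Ordinal a1)).
Qed.

(** Every cut of [a] other than the one after its last component has a first
    part with fewer rows, so the convolution of [X] with [exp_map] determines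
    [X a] by induction on the number of rows of [a]. *)
Lemma left_inverse_uniq (X Y : comp d -> H) :
  (forall a, \sum_(x <- splits a) qmul (X x.1) (exp_map << x.2 >>) =
             \sum_(x <- splits a) qmul (Y x.1) (exp_map << x.2 >>)) ->
  X =1 Y.
Proof.
move=> e; pose D a := X a - Y a.
suff D0 a : D a = 0 by move=> a; apply/eqP; rewrite -subr_eq0 -/(D a) D0.
have eD b : \sum_(x <- splits b) qmul (D x.1) (exp_map << x.2 >>) = 0.
  have /eqP := e b; rewrite -subr_eq0 -sumrB => /eqP e0.
  apply: etrans e0; apply: eq_bigr => x _.
  by rewrite -[LHS]/(bilin_extr _ _ _) linearB.
have [n] := ubnP (nrows a); elim: n a => // n IH a.
rewrite ltnS => le_an.
have as0 : (a, cempty) \in splits a by rewrite mem_splits cdiagc0.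
have := eD a; rewrite (bigD1_seq _ as0 (splits_uniq a)) /=.
rewrite exp_map_qmul1r big1_seq ?addr0 // => -[b c] /andP[ne].
rewrite mem_splits /= => /eqP ea.
rewrite -[LHS]/(bilin_extr _ _ _) IH ?linear0 //.
apply: leq_trans le_an; rewrite -ea nrows_cdiag -[X in (X < _)%N]addn0 ltn_add2l.
rewrite lt0n; apply: contra ne => /eqP/nrows_eq0 c0.
by rewrite -ea c0 cdiagc0.
Qed.

(** Composing the antipode equation of the source with [exp_map], and that of
    the target with [exp_map] on the right, shows that both sides are left
    convolution inverses of [exp_map]. *)
Lemma exp_map_antipode SA SB :
  is_antipode (shuffle_hopf K d) SA -> is_antipode (qshuffle_hopf K d) SB ->
  forall x, exp_map (SA x) = SB (exp_map x).
Proof.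
move=> hA hB.
pose F := [the {linear _ -> _} of exp_map \o SA].
pose G := [the {linear _ -> _} of SB \o exp_map].
move=> x; apply: (eq_linear_basis (f := F) (g := G) _ x) => {x}.
apply: (@left_inverse_uniq (fun a => exp_map (SA << a >>))
  (fun a => SB (exp_map << a >>))) => a.
have comulU : comul (<< a >> : H) = \sum_(x <- splits a) << x >>.
  exact: etrans (lin_extU _ _) (comul_basisE K a).
transitivity (counit (K := K) << a >> *: (<< cempty >> : H)).
  have [eA _] := hA << a >>.
  apply: etrans _ (etrans (congr1 exp_map eA) _); last first.
    exact: etrans (linearZ_LR _ _ _) (congr1 ( *:%R _) exp_map_one).
  rewrite /convolution -[hcomul _ _]/(comul << a >>) comulU lin_ext_sumU.
  by rewrite linear_sum; apply: eq_bigr => x _; rewrite -exp_map_mul.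
have [eB _] := hB (exp_map << a >>).
rewrite -exp_map_counit; apply: etrans (esym eB) _.
rewrite /convolution -[hcomul _ _]/(comul (exp_map << a >>)) exp_map_comul comulU.
rewrite /tensor_map lin_ext_sumU linear_sum; apply: eq_bigr => x _.
rewrite [LHS]lin_ext_tensor.
exact/esym/bilin_ext_comp.
Qed.

Theorem shuffle_qshuffle_isomorphic :
  hopf_isomorphic (shuffle_hopf K d) (qshuffle_hopf K d).
Proof.
exists exp_map; split.
- exact: exp_map_bij.
- exact: exp_map_one.
- exact: exp_map_mul.
- exact: exp_map_counit.
- exact: exp_map_comul.
- exact: exp_map_antipode.
Qed.

End Isomorphism.

Theorem theorem4p1 (K : comAlgType rat) (d : nat) (hd : (1 <= d)%N) :
  hopf_isomorphic (shuffle_hopf K d) (qshuffle_hopf K d).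
Proof. exact: (shuffle_qshuffle_isomorphic (GRing.in_alg K) d). Qed.
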